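(* The discrete logarithmic function $\ell$ is isomonodromic: for a proper choice of $A(\boldsymbol{0};\lambda)$, the matrices $A(\boldsymbol{n};\lambda)$ built from $f=\ell$ at any point $\boldsymbol{n}\in(\mathbb{Z}_+)^d=S_1$ have simple poles only: $$A(\boldsymbol{n};\lambda)=\frac{A^{(0)}(\boldsymbol{n})}{\lambda}+\sum_{l=1}^d\Big(\frac{B^{(l)}(\boldsymbol{n})}{\lambda+\theta_l}+\frac{C^{(l)}(\boldsymbol{n})}{\lambda-\theta_l}\Big),$$ with $$A^{(0)}(\boldsymbol{n})=\begin{pmatrix}0&(-1)^{n_1+\ldots+n_d}\\0&0\end{pmatrix},\quad B^{(l)}(\boldsymbol{n})=n_l\begin{pmatrix}1&-(\ell(\boldsymbol{n})+\ell(\boldsymbol{n}-\boldsymbol{e}_l))\\0&0\end{pmatrix},\quad C^{(l)}(\boldsymbol{n})=n_l\begin{pmatrix}0&\ell(\boldsymbol{n}+\boldsymbol{e}_l)+\ell(\boldsymbol{n})\\0&1\end{pmatrix}.$$ At any point $\boldsymbol{n}\in\widetilde{S}$ the following constraint holds: $$\sum_{l=1}^dn_l\big(\ell(\boldsymbol{n}+\boldsymbol{e}_l)-\ell(\boldsymbol{n}-\boldsymbol{e}_l)\big)=1-(-1)^{n_1+\ldots+n_d}.$$ (Terms with $n_l=0$ are understood to vanish.)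
   Context: Let $\theta_1,\ldots,\theta_d\in\mathbb{S}^1$ be such that $\theta_1,\ldots,\theta_d,-\theta_1,\ldots,-\theta_d$ are distinct and occur in this circular (counterclockwise) order on the unit circle. Put $\theta_{k+d}=-\theta_k$ and extend $\theta_r$ to $r\in\mathbb{Z}$ by $2d$-periodicity. Choose $\gamma_r\in\mathbb{R}$ with $\theta_r=\exp(i\gamma_r)$, $\gamma_{r+1}-\gamma_r\in(0,\pi)$. Let $\boldsymbol{e}_1,\ldots,\boldsymbol{e}_d$ be the unit vectors of $\mathbb{Z}^d$, $\boldsymbol{e}_{k+d}=-\boldsymbol{e}_k$, extended by $2d$-periodicity. $S_m$ is the octant of $\boldsymbol{n}=\sum_{r=m}^{m+d-1}n_r\boldsymbol{e}_r$ with integers $n_r\ge0$; $\widetilde{S}_m$ is $S_m$ equipped with the values $\log\theta_r=i\gamma_r$, $r\in[m,m+d-1]$; $\widetilde{S}=\bigcup_m\widetilde{S}_m$ (a branched covering of $\bigcup_{m=1}^{2d}S_m\subset\mathbb{Z}^d$, gluing along common semi-axes with matching $\log\theta_r$). In the constraint, $n_1,\ldots,n_d$ are the coordinates of the underlying point in $\mathbb{Z}^d$, and the points $\boldsymbol{n}\pm\boldsymbol{e}_l$ with $n_l\ne0$ are taken in the same $\widetilde{S}_m$ as $\boldsymbol{n}$. Discrete logarithmic function: for $\boldsymbol{n}\in\widetilde{S}_m$, $\ell(\boldsymbol{n})=\frac{1}{2\pi i}\int_\Gamma\frac{\log(\lambda)}{2\lambda}\prod_{r=m}^{m+d-1}\Big(\frac{\lambda+\theta_r}{\lambda-\theta_r}\Big)^{n_r}d\lambda$,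 where $\Gamma$ consists of $d$ small counterclockwise loops around $\theta_m,\ldots,\theta_{m+d-1}$, with the branch of $\log\lambda$ near $\theta_r$ satisfying $\log\theta_r=i\gamma_r$. It satisfies the discrete Cauchy-Riemann equations $(\theta_j-\theta_k)\big(\ell(\boldsymbol{n}+\boldsymbol{e}_j+\boldsymbol{e}_k)-\ell(\boldsymbol{n})\big)=(\theta_j+\theta_k)\big(\ell(\boldsymbol{n}+\boldsymbol{e}_j)-\ell(\boldsymbol{n}+\boldsymbol{e}_k)\big)$. For a function $f$ satisfying these equations, the transition matrices are $L_k(\boldsymbol{n};\lambda)=\begin{pmatrix}\lambda+\theta_k&-2\theta_k(f(\boldsymbol{n}+\boldsymbol{e}_k)+f(\boldsymbol{n}))\\0&\lambda-\theta_k\end{pmatrix}$. The $2\times2$ matrices $A(\boldsymbol{n};\lambda)$ are determined by a choice of $A(\boldsymbol{0};\lambda)$ and the (consistent) recurrent relation $$A(\boldsymbol{n}+\boldsymbol{e}_k;\lambda)=\frac{dL_k(\boldsymbol{n};\lambda)}{d\lambda}L_k^{-1}(\boldsymbol{n};\lambda)+L_k(\boldsymbol{n};\lambda)A(\boldsymbol{n};\lambda)L_k^{-1}(\boldsymbol{n};\lambda).$$ $f$ is called isomonodromic if, for some choice of $A(\boldsymbol{0};\lambda)$, the matrices $A(\boldsymbol{n};\lambda)$ are meromorphic in $\lambda$ with poles whose positions and orders do not depend on $\boldsymbol{n}$. $\mathbb{Z}_+$ denotes the non-negative integers. *)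

(* Defs.v *)
From HB Require Import structures.
From mathcomp Require Import all_boot all_order all_algebra.
From mathcomp Require Import complex.
From mathcomp Require Import all_classical all_reals all_analysis.
From mathcomp Require Import zify.
Import Order.TTheory GRing.Theory Num.Theory.
Import numFieldNormedType.Exports.

Set Implicit Arguments.
Unset Strict Implicit.
Unset Printing Implicit Defensive.

Local Open Scope classical_set_scope.
Local Open Scope complex_scope.
Local Open Scope ring_scope.

(** * Complex preliminaries *)

Definition expi (R : realType) (t : R) : R[i] := cos t +i* sin t.

Definition contour_circle (R : realType) (f : R[i] -> R[i]) (c : R[i]) (rho : R)
    : R[i] :=
  let g t := f (c + rho%:C * expi t) * ('i%C * rho%:C * expi t) in
  (\int[@lebesgue_measure R]_(t in `[0, 2 * pi]) complex.Re (g t))%R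
  +i* (\int[@lebesgue_measure R]_(t in `[0, 2 * pi]) complex.Im (g t))%R.

(* Principal logarithm; the formula is used, and correct, only for Re z > 0. *)
Definition plog (R : realType) (z : R[i]) : R[i] :=
  ln (Normc.normc z) +i* atan (complex.Im z / complex.Re z).

(* The branch of log near expi g that takes the value i g at expi g. On the disc
   of radius 1 about expi g, the quotient z / expi g has positive real part. *)
Definition log_branch (R : realType) (g : R) (z : R[i]) : R[i] :=
  'i%C * g%:C + plog (z / expi g).

(* g is meromorphic at z0, with a pole of order at most o (o = 0: g is regular
   at z0, up to its value at z0). *)
Definition pole_order_le (R : realType) (o : nat) (g : R[i] -> R[i]) (z0 : R[i])
    : Prop :=
  exists h : (R[i])^o -> (R[i])^o,
    (\forall z \near (z0 : (R[i])^o), derivable h z 1) /\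
    (\forall z \near (z0 : (R[i])^o)^', g z = h z / (z - z0) ^+ o).

Definition ccw_ordered (R : realType) (n : nat) (z : nat -> R[i]) : Prop :=
  exists alpha : nat -> R,
    (forall i, (i < n)%N -> z i = expi (alpha i)) /\
    (forall i j, (i < j < n)%N -> alpha i < alpha j < alpha i + 2 * pi).

(** * The lattice and its octants *)

(* The 2d-periodic family e_r (r in Z) with e_1, ..., e_d the standard basis and
   e_(r+d) = - e_r. Column i : 'I_d holds the coordinate number i.+1. *)
Definition unit_vec (d : nat) (r : int) : 'rV[int]_d :=
  \row_(i < d) ((((2 * d)%N%:Z %| r - i.+1%:Z)%Z : nat)%:Z
                - (((2 * d)%N%:Z %| r - (i.+1 + d)%N%:Z)%Z : nat)%:Z).

Definition octant (d : nat) (m : int) (n : 'rV[int]_d) : Prop :=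
  exists c : 'I_d -> nat, n = \sum_(j < d) unit_vec d (m + j%:Z) *+ c j.

Definition orthant (d : nat) (n : 'rV[int]_d) : Prop :=
  forall i : 'I_d, 0 <= n 0 i.

(* The coefficient n_r of e_r in n = \sum_(m <= r < m + d) n_r e_r, obtained as the
   scalar product of n and e_r; see [coef_octant]. *)
Definition coef (d : nat) (r : int) (n : 'rV[int]_d) : int :=
  \sum_(i < d) n 0 i * unit_vec d r 0 i.

Lemma unit_vec_eq0 (d : nat) (r : int) (i : 'I_d) :
  ~~ (d%:Z %| r - i.+1%:Z)%Z -> unit_vec d r 0 i = 0.
Proof.
rewrite mxE PoszD PoszM opprD addrA; set x := r - i.+1%:Z => ndx.
have no y : ~~ (d%:Z %| y)%Z -> (2%:Z * d%:Z %| y)%Z = false.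
  by move=> h; apply: contraNF h => /dvdzP[q ->]; rewrite mulrA dvdz_mull.
rewrite !no ?subrr //; apply: contraNN ndx => /dvdzP[q e].
by apply/dvdzP; exists (q + 1); lia.
Qed.

Lemma unit_vec_sqr (d : nat) (r : int) (i : 'I_d) :
  (d%:Z %| r - i.+1%:Z)%Z -> unit_vec d r 0 i * unit_vec d r 0 i = 1.
Proof.
have id := ltn_ord i; rewrite mxE PoszD PoszM opprD addrA.
set x := r - i.+1%:Z => /dvdzP[q ->].
have d0 : d%:Z != 0 by lia.
have -> : q * d%:Z - d%:Z = (q - 1) * d%:Z by lia.
rewrite !dvdz_mul2r //; lia.
Qed.

Lemma eq_lt_dvd (d x y : nat) (q : int) :
  (x < d)%N -> (y < d)%N -> x%:Z - y%:Z = q * d%:Z -> x = y.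
Proof.
move=> xd yd e; have [q0|[q1|q1]] : q = 0 \/ (1 <= q \/ q <= -1) by lia.
- by move: e; rewrite q0; lia.
- have : d%:Z <= q * d%:Z by rewrite ler_peMl. lia.
- have : q * d%:Z <= -1 * d%:Z by rewrite ler_wpM2r. lia.
Qed.

Lemma coef_octant (d : nat) (m : int) (c : 'I_d -> nat) (k : 'I_d) :
  coef (m + k%:Z) (\sum_(j < d) unit_vec d (m + j%:Z) *+ c j) = c k.
Proof.
have kd := ltn_ord k; rewrite /coef.
have [i0 i0k] : exists i0 : 'I_d, (d%:Z %| m + k%:Z - i0.+1%:Z)%Z.
  have lt : (`|((m + k%:Z - 1) %% d)%Z|%N < d)%N by lia.
  exists (Ordinal lt); apply/dvdzP; exists ((m + k%:Z - 1) %/ d)%Z => /=; lia.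
have neq0 (r : int) : (d%:Z %| r - i0.+1%:Z)%Z ->
    forall i, i != i0 -> unit_vec d r 0 i = 0.
  move=> /dvdzP[a ea] i ii0; apply: unit_vec_eq0; apply/negP => /dvdzP[b eb].
  move/negP: ii0; apply; apply/eqP/val_inj => /=.
  apply: (@eq_lt_dvd d i i0 (a - b)); rewrite ?ltn_ord //; lia.
rewrite (bigD1 i0) //= [X in _ + X]big1 ?addr0 => [|i ii0]; last first.
  by rewrite (neq0 (m + k%:Z)) ?mulr0.
rewrite summxE (bigD1 k) //= big1 ?addr0 => [|j jk]; last first.
  rewrite mulmxnE unit_vec_eq0 ?mul0rn //; apply/negP => /dvdzP[b eb].
  have /dvdzP[a ea] := i0k; move/negP: jk; apply; apply/eqP/val_inj => /=.
  apply: (@eq_lt_dvd d j k (b - a)); rewrite ?ltn_ord //; lia.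
by rewrite mulmxnE mulrnAl unit_vec_sqr // natz.
Qed.

(** * The discrete logarithmic function *)

(* Standing assumptions: theta_1, ..., theta_2d are in counterclockwise order (in
   particular distinct), with theta_(r+d) = - theta_r, and i gamma_r is the
   chosen logarithm of theta_r. *)
Definition directions (R : realType) (d : nat) (theta : int -> R[i])
    (gamma : int -> R) : Prop :=
  [/\ forall r : int, theta (r + d%:Z) = - theta r,
      ccw_ordered (2 * d) (fun i => theta i.+1%:Z),
      forall r, theta r = expi (gamma r) &
      forall r : int, 0 < gamma (r + 1) - gamma r < pi].

(* The circle of radius rho about any theta_r encloses neither 0 nor any other
   theta_s. *)
Definition small_radius (R : realType) (theta : int -> R[i]) (rho : R) : Prop :=
  [/\ 0 < rho, rho < 1 &
      forall r s, theta r != theta s -> rho < Normc.normc (theta r - theta s)].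

(* A point of the branched covering is a pair (m, n) with n in the octant S_m.
   [ell theta gamma rho m] is the function on the sheet over S_m; the circles of
   radius rho are the loops of Gamma. *)
Definition ell (R : realType) (d : nat) (theta : int -> R[i]) (gamma : int -> R)
    (rho : R) (m : int) (n : 'rV[int]_d) : R[i] :=
  (2 * pi%:C * 'i%C)^-1 *
  \sum_(k < d) contour_circle
    (fun z => log_branch (gamma (m + k%:Z)) z / (2 * z) *
       \prod_(j < d) ((z + theta (m + j%:Z)) / (z - theta (m + j%:Z)))
                       ^ coef (m + j%:Z) n)
    (theta (m + k%:Z)) rho.

(** * Isomonodromic solutions of the discrete Cauchy-Riemann equations *)

(* In the sequel k : 'I_d stands for the index k.+1 in {1, ..., d}. *)
Definition discrete_CR (R : realType) (d : nat) (theta : int -> R[i])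
    (f : 'rV[int]_d -> R[i]) : Prop :=
  forall n, orthant n -> forall j k : 'I_d,
    let tj := theta j.+1%:Z in let tk := theta k.+1%:Z in
    let ej := unit_vec d j.+1%:Z in let ek := unit_vec d k.+1%:Z in
    (tj - tk) * (f (n + ej + ek) - f n) = (tj + tk) * (f (n + ej) - f (n + ek)).

Definition mx2 (T : Type) (a b c e : T) : 'M[T]_2 :=
  \matrix_(i < 2, j < 2)
    if i == ord0 then (if j == ord0 then a else b)
    else (if j == ord0 then c else e).

Definition transition (R : realType) (d : nat) (theta : int -> R[i])
    (f : 'rV[int]_d -> R[i]) (k : 'I_d) (n : 'rV[int]_d) (z : R[i]) : 'M[R[i]]_2 :=
  let t := theta k.+1%:Z in
  mx2 (z + t) (- 2 * t * (f (n + unit_vec d k.+1%:Z) + f n)) 0 (z - t).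

Definition mx_derive (R : realType) (M : R[i] -> 'M[R[i]]_2) (z : R[i])
    : 'M[R[i]]_2 :=
  \matrix_(i < 2, j < 2) derive1 (fun w : (R[i])^o => M w i j : (R[i])^o) z.

(* A is the family determined by A(0; z) = A0 z and by the recurrent relation;
   functions of z are considered off the finite set P, and the relation is
   imposed where L_k is invertible. *)
Definition connection_family (R : realType) (d : nat) (theta : int -> R[i])
    (f : 'rV[int]_d -> R[i]) (P : seq R[i]) (A0 : R[i] -> 'M[R[i]]_2)
    (A : 'rV[int]_d -> R[i] -> 'M[R[i]]_2) : Prop :=
  (forall z, z \notin P -> A 0 z = A0 z) /\
  forall n, orthant n -> forall (k : 'I_d) z, z \notin P ->
    let L := transition theta f k n in
    L z \in unitmx ->
    A (n + unit_vec d k.+1%:Z) z =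
      mx_derive L z *m invmx (L z) + L z *m A n z *m invmx (L z).

(* The positions (in P) and the orders (bounded by o) of the poles do not depend
   on n. They are upper bounds: individual residues may vanish, as they do for
   ell at the points where some coordinate of n is 0. *)
Definition isomonodromic (R : realType) (d : nat) (theta : int -> R[i])
    (f : 'rV[int]_d -> R[i]) : Prop :=
  discrete_CR theta f /\
  exists (P : seq R[i]) (o : R[i] -> nat) (A0 : R[i] -> 'M[R[i]]_2)
      (A : 'rV[int]_d -> R[i] -> 'M[R[i]]_2),
    connection_family theta f P A0 A /\
    forall n, orthant n -> forall (i j : 'I_2) z,
      pole_order_le (if z \in P then o z else 0%N) (fun w => A n w i j) z.

(** * The explicit matrices *)

Definition singular_points (R : realType) (d : nat) (theta : int -> R[i])
    : seq R[i] :=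
  0 :: [seq theta l.+1%:Z | l : 'I_d] ++ [seq - theta l.+1%:Z | l : 'I_d].

Definition res_zero (R : realType) (d : nat) (n : 'rV[int]_d) : 'M[R[i]]_2 :=
  mx2 0 ((-1) ^ (\sum_(i < d) n 0 i)) 0 0.

Definition res_minus (R : realType) (d : nat) (f : 'rV[int]_d -> R[i])
    (l : 'I_d) (n : 'rV[int]_d) : 'M[R[i]]_2 :=
  (n 0 l)%:~R *: mx2 1 (- (f n + f (n - unit_vec d l.+1%:Z))) 0 0.

Definition res_plus (R : realType) (d : nat) (f : 'rV[int]_d -> R[i])
    (l : 'I_d) (n : 'rV[int]_d) : 'M[R[i]]_2 :=
  (n 0 l)%:~R *: mx2 0 (f (n + unit_vec d l.+1%:Z) + f n) 0 1.

Definition simple_pole_form (R : realType) (d : nat) (theta : int -> R[i])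
    (f : 'rV[int]_d -> R[i]) (n : 'rV[int]_d) (z : R[i]) : 'M[R[i]]_2 :=
  z^-1 *: res_zero R n +
  \sum_(l < d) ((z + theta l.+1%:Z)^-1 *: res_minus f l n
                + (z - theta l.+1%:Z)^-1 *: res_plus f l n).

(* Main.v *)
Require Import Defs.
From mathcomp Require Import all_boot all_order all_algebra.
From mathcomp Require Import complex.
From mathcomp Require Import all_classical all_reals all_analysis.
From mathcomp Require Import zify ring lra.
Import Order.TTheory GRing.Theory Num.Theory.
Import numFieldNormedType.Exports.

Set Implicit Arguments.
Unset Strict Implicit.
Unset Printing Implicit Defensive.

Local Open Scope complex_scope.
Local Open Scope ring_scope.

(** Write Phi_n for the product in the integrand of ell. Since Phi_n satisfies the
    discrete Cauchy-Riemann equations pointwise, so does ell. The integrand of the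
    left-hand side of the constraint is - (log z) Phi_n'(z); integrating by parts along
    each loop turns it into Phi_n(z) / z, whose residues at the theta_r sum up to
    Phi_n(oo) - Phi_n(0) = 1 - (-1)^|n|. This sum is evaluated by partial fractions, so
    that only the contour integrals of (z - a)^-k enter. Given the constraint, the
    recurrence for the explicit simple-pole matrices reduces to the Cauchy-Riemann
    equations at n and n - e_l for the residues, and to the constraint at n and n + e_k
    for the behaviour at infinity. *)

(** * Derivatives of complex-valued functions of a real variable *)

Section ComplexDerivative.
Variable R : realType.
Implicit Types (f g : R -> R[i]) (t : R) (df dg c : R[i]).

(** All analysis is done along the circles themselves: a contour integral is a pair of real
    integrals over the parameter, and it vanishes as soon as the integrand has a single-valued
    primitive along the circle. The logarithm qualifies on each loop because [rho < 1] keeps 0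
    outside. The only integral not settled by a primitive is that of 1/(z - c) around c. The
    constraint is stated in the coordinates n_1, ..., n_d, which may be negative on a general sheet,
    while the partial fractions need a product whose poles are the loop centres only, that is,
    non-negative exponents. It is therefore proved in the coordinates of the octant S_m and then
    transported, each of its terms being invariant under r -> r + d. The connection matrices involve
    no integrals any more: their recurrence is proved for every f that satisfies the Cauchy-Riemann
    equations and the constraint on the orthant. The alternating sign in A^(0) is forced there,
    since the right-hand sides of the constraint at n + e_k and at n differ by 2 (-1)^|n|. *)

Lemma is_derive_ext (f g : R -> R) t (df dg : R) :
  is_derive t (1 : R) f df -> g =1 f -> dg = df -> is_derive t (1 : R) g dg.
Proof. by move=> + /funext -> ->. Qed.

Lemma is_derive_inv (h : R -> R) t (dh : R) : h t != 0 ->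
  is_derive t (1 : R) h dh -> is_derive t (1 : R) (fun s => (h s)^-1) (- dh / h t ^+ 2).
Proof.
move=> ht dhP; apply: DeriveDef; first exact: derivableV.
by rewrite deriveV // derive_val /GRing.scale /= mulrC mulrN mulNr.
Qed.

(** Componentwise, like the definition of [contour_circle], so that real differentiation rules and
    the real fundamental theorem of calculus apply directly. *)
Definition has_cderiv g t dg :=
  is_derive t (1 : R) (fun s => complex.Re (g s)) (complex.Re dg) /\
  is_derive t (1 : R) (fun s => complex.Im (g s)) (complex.Im dg).

Lemma complex_ReD (x y : R[i]) : complex.Re (x + y) = complex.Re x + complex.Re y.
Proof. by case: x y => [a b] [c d]. Qed.

Lemma complex_ImD (x y : R[i]) : complex.Im (x + y) = complex.Im x + complex.Im y.
Proof. by case: x y => [a b] [c d]. Qed.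

Lemma complex_ReM (x y : R[i]) :
  complex.Re (x * y) = complex.Re x * complex.Re y - complex.Im x * complex.Im y.
Proof. by case: x y => [a b] [c d]. Qed.

Lemma complex_ImM (x y : R[i]) :
  complex.Im (x * y) = complex.Re x * complex.Im y + complex.Im x * complex.Re y.
Proof. by case: x y => [a b] [c d]. Qed.

Lemma complex_ReV (x : R[i]) :
  complex.Re x^-1 = complex.Re x / (complex.Re x ^+ 2 + complex.Im x ^+ 2).
Proof. by case: x. Qed.

Lemma complex_ImV (x : R[i]) :
  complex.Im x^-1 = - complex.Im x / (complex.Re x ^+ 2 + complex.Im x ^+ 2).
Proof. by case: x => a b /=; rewrite mulNr. Qed.

Lemma complex_ext (x y : R[i]) :
  complex.Re x = complex.Re y -> complex.Im x = complex.Im y -> x = y.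
Proof. by case: x y => [a b] [c d] /= -> ->. Qed.

Lemma sqr_norm_neq0 (x : R[i]) :
  x != 0 -> complex.Re x ^+ 2 + complex.Im x ^+ 2 != 0.
Proof.
case: x => a b /=; rewrite eq_complex /= => h.
by rewrite paddr_eq0 ?sqr_ge0 // !sqrf_eq0.
Qed.

Lemma has_cderiv_eq g t dg dg' : has_cderiv g t dg -> dg = dg' -> has_cderiv g t dg'.
Proof. by move=> + <-. Qed.

Lemma has_cderiv_cst c t : has_cderiv (fun=> c) t 0.
Proof. by split; apply: is_derive_cst. Qed.

Lemma has_cderivD f g t df dg :
  has_cderiv f t df -> has_cderiv g t dg -> has_cderiv (fun s => f s + g s) t (df + dg).
Proof.
move=> [f1 f2] [g1 g2]; split.
- by apply: is_derive_ext (is_deriveD f1 g1) _ _; rewrite ?raddfD // => s; rewrite raddfD.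
- by apply: is_derive_ext (is_deriveD f2 g2) _ _; rewrite ?raddfD // => s; rewrite raddfD.
Qed.

Lemma has_cderivM f g t df dg :
  has_cderiv f t df -> has_cderiv g t dg ->
  has_cderiv (fun s => f s * g s) t (df * g t + f t * dg).
Proof.
move=> [f1 f2] [g1 g2]; split.
- apply: is_derive_ext (is_deriveB (is_deriveM f1 g1) (is_deriveM f2 g2)) _ _.
    by move=> s; rewrite complex_ReM.
  rewrite raddfD /= !complex_ReM /GRing.scale /=; ring.
- apply: is_derive_ext (is_deriveD (is_deriveM f1 g2) (is_deriveM f2 g1)) _ _.
    by move=> s; rewrite complex_ImM.
  rewrite raddfD /= !complex_ImM /GRing.scale /=; ring.
Qed.

Lemma is_derive_sqr_norm g t dg : has_cderiv g t dg ->
  is_derive t (1 : R) (fun s => complex.Re (g s) ^+ 2 + complex.Im (g s) ^+ 2)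
    (2 * complex.Re (g t) * complex.Re dg + 2 * complex.Im (g t) * complex.Im dg).
Proof.
move=> [g1 g2]; apply: is_derive_ext (is_deriveD (is_deriveX 2 g1) (is_deriveX 2 g2)) _ _ => //.
Qed.

Lemma has_cderivV g t dg : g t != 0 ->
  has_cderiv g t dg -> has_cderiv (fun s => (g s)^-1) t (- dg / g t ^+ 2).
Proof.
move=> g0 gP; have n0 := sqr_norm_neq0 g0.
have dN := is_derive_inv (h := fun s => complex.Re (g s) ^+ 2 + complex.Im (g s) ^+ 2) n0
  (is_derive_sqr_norm gP); have [g1 g2] := gP.
have inv2 : (g t ^+ 2)^-1 = (g t)^-1 * (g t)^-1 by rewrite expr2 invfM.
have n0' : complex.Re (g t) * complex.Re (g t) + complex.Im (g t) * complex.Im (g t) != 0.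
  by rewrite -!expr2.
split.
- apply: is_derive_ext (is_deriveM g1 dN) _ _; first by move=> s; rewrite complex_ReV.
  rewrite /GRing.scale /= inv2 !(complex_ReM, complex_ReV, complex_ImV, complex_ImM, raddfN) /=.
  by field.
- apply: is_derive_ext (is_deriveM (is_deriveN g2) dN) _ _.
    by move=> s; rewrite complex_ImV.
  rewrite /GRing.scale /= inv2 !(complex_ReM, complex_ReV, complex_ImV, complex_ImM, raddfN) /=.
  change ((- (fun s : R => complex.Im (g s))) t) with (- complex.Im (g t)).
  by field.
Qed.

(** The derivative is displayed as logarithmic derivative times function, uniformly in the sign of
    k, because [has_cderiv_prod] expects this shape. *)
Lemma has_cderiv_exprz g t dg (k : int) : g t != 0 -> has_cderiv g t dg ->
  has_cderiv (fun s => g s ^ k) t (k%:~R * dg / g t * g t ^ k).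
Proof.
move=> g0 gP.
have natP (n : nat) : has_cderiv (fun s => g s ^+ n) t (n%:R * dg / g t * g t ^+ n).
  elim: n => [|n IH].
    by rewrite !mul0r; apply: has_cderiv_cst.
  have := has_cderivM gP IH => /has_cderiv_eq h.
  have -> : (fun s => g s ^+ n.+1) = (fun s => g s * g s ^+ n).
    by apply/funext => s; rewrite exprS.
  by apply: h; rewrite exprS -natr1; field.
case: k => n; first by apply: has_cderiv_eq (natP n) _.
have gn0 : g t ^+ n.+1 != 0 by rewrite expf_neq0.
have := has_cderivV gn0 (natP n.+1) => /has_cderiv_eq; apply.
rewrite NegzE mulrNz -exprnN expr2; field.
by rewrite gn0 g0.
Qed.

Lemma has_cderiv_prod (I : Type) (r : seq I) (F : I -> R -> R[i]) (a : I -> R[i]) t :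
  (forall i, has_cderiv (F i) t (a i * F i t)) ->
  has_cderiv (fun s => \prod_(i <- r) F i s) t
    ((\sum_(i <- r) a i) * \prod_(i <- r) F i t).
Proof.
move=> FP; elim: r => [|i r IH].
  have -> : (fun s => \prod_(i <- [::]) F i s) = fun=> 1.
    by apply/funext => s; rewrite big_nil.
  by rewrite !big_nil mul0r; apply: has_cderiv_cst.
have -> : (fun s => \prod_(i <- i :: r) F i s) = fun s => F i s * \prod_(i <- r) F i s.
  by apply/funext => s; rewrite big_cons.
by apply: has_cderiv_eq (has_cderivM (FP i) IH) _; rewrite !big_cons; ring.
Qed.

Lemma is_derive_ln_comp (h : R -> R) t (dh : R) : 0 < h t ->
  is_derive t (1 : R) h dh -> is_derive t (1 : R) (fun s => ln (h s)) (dh / h t).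
Proof.
move=> h0 hP; apply: is_derive_ext (is_derive1_comp (is_derive1_ln h0) hP) _ _ => //.
exact: mulrC.
Qed.

(** The real part ln |g| and the imaginary part atan (Im g / Re g) contribute the real and imaginary
    parts of dg / g; positivity of Re g makes the second formula the argument. *)
Lemma has_cderiv_plog g t dg : 0 < complex.Re (g t) ->
  has_cderiv g t dg -> has_cderiv (fun s => plog (g s)) t (dg / g t).
Proof.
move=> g0 gP; have [g1 g2] := gP.
have re0 : complex.Re (g t) != 0 by rewrite gt_eqF.
have N0 : 0 < complex.Re (g t) ^+ 2 + complex.Im (g t) ^+ 2.
  by rewrite ltr_pwDl ?exprn_gt0 ?sqr_ge0.
have n0 := lt0r_neq0 N0.
have n0' : complex.Re (g t) * complex.Re (g t) + complex.Im (g t) * complex.Im (g t) != 0.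
  by rewrite -!expr2.
split.
- have s1 := is_derive1_comp (g := fun s => complex.Re (g s) ^+ 2 + complex.Im (g s) ^+ 2)
    (is_derive1_sqrt N0) (is_derive_sqr_norm gP).
  have := is_derive_ln_comp _ s1; rewrite /= sqrtr_gt0 => /(_ N0) s2.
  apply: is_derive_ext s2 _ _.
    by move=> s; rewrite /plog /=; case: (g s).
  rewrite !(complex_ReM, complex_ReV, complex_ImV).
  set q := Num.sqrt _; have q2 : q * q = complex.Re (g t) ^+ 2 + complex.Im (g t) ^+ 2.
    by rewrite -expr2 sqr_sqrtr // ltW.
  have q0 : q != 0 by rewrite gt_eqF // sqrtr_gt0.
  rewrite -q2; field.
  by rewrite q0.
- have dQ := is_deriveM g2 (is_derive_inv (h := fun s => complex.Re (g s)) re0 g1).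
  have h := is_derive1_comp (g := fun s => complex.Im (g s) / complex.Re (g s))
    (is_derive1_atan _) dQ.
  apply: is_derive_ext h _ _; first by [].
  rewrite /GRing.scale /= !(complex_ImM, complex_ReV, complex_ImV); field.
  by rewrite n0 re0.
Qed.
End ComplexDerivative.

(** * Contour integrals over circles: linearity and primitives *)

Section Contour.
Variable R : realType.
Implicit Types (f g F : R[i] -> R[i]) (t rho : R) (c : R[i]).

Definition circle_point c rho t : R[i] := c + rho%:C * expi t.

(** A convenient sufficient condition for continuity along the circle, hence for integrability, that
    is stable under the algebraic operations. *)
Definition circle_diff c rho f :=
  forall t, exists df, has_cderiv (fun s => f (circle_point c rho s)) t df.

(** Only the derivative along the circle is prescribed, so F need not be known to be holomorphic. *)
Definition circle_primitive c rho F f :=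
  forall t, has_cderiv (fun s => F (circle_point c rho s)) t
    (f (circle_point c rho t) * ('i%C * rho%:C * expi t)).

Definition cintegral (h : R -> R[i]) : R[i] :=
  (\int[@lebesgue_measure R]_(t in `[0, 2 * pi]%classic) complex.Re (h t))%R
  +i* (\int[@lebesgue_measure R]_(t in `[0, 2 * pi]%classic) complex.Im (h t))%R.

Lemma contour_circleE f c rho :
  contour_circle f c rho =
  cintegral (fun t => f (circle_point c rho t) * ('i%C * rho%:C * expi t)).
Proof. by []. Qed.

Lemma has_cderiv_expi t : has_cderiv (@expi R) t ('i%C * expi t).
Proof.
split; [apply: is_derive_ext (is_derive_cos t) _ _ | apply: is_derive_ext (is_derive_sin t) _ _];
  rewrite //= ?complex_ReM ?complex_ImM /=; ring.
Qed.

Lemma has_cderiv_circle_point c rho t :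
  has_cderiv (circle_point c rho) t ('i%C * rho%:C * expi t).
Proof.
have := has_cderivD (has_cderiv_cst c t)
  (has_cderivM (has_cderiv_cst rho%:C t) (has_cderiv_expi t)).
by move=> /has_cderiv_eq; apply; ring.
Qed.

Lemma continuous_has_cderiv (h : R -> R[i]) : (forall t, exists dh, has_cderiv h t dh) ->
  continuous (fun s => complex.Re (h s)) /\ continuous (fun s => complex.Im (h s)).
Proof.
by move=> hP; split=> t; have [dh [h1 h2]] := hP t;
  apply: differentiable_continuous; apply/derivable1_diffP; exact: ex_derive.
Qed.

Lemma circle_continuous_integrable (h : R -> R) : continuous h ->
  (@lebesgue_measure R).-integrable `[0, 2 * pi]%classic (EFin \o h).
Proof.
move=> hc; apply: continuous_compact_integrable; first exact: segment_compact.
exact: continuous_subspaceT.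
Qed.

Lemma cintegral_linear (a : R[i]) (h k : R -> R[i]) :
  (forall t, exists dh, has_cderiv h t dh) -> (forall t, exists dk, has_cderiv k t dk) ->
  cintegral (fun t => a * h t + k t) = a * cintegral h + cintegral k.
Proof.
move=> /continuous_has_cderiv[h1 h2] /continuous_has_cderiv[k1 k2].
have m := measurable_itv `[0 : R, 2 * pi].
have Z (r : R) (u : R -> R) : continuous u -> continuous (fun s => r * u s).
  by move=> uc s; apply: cvgM; [exact: cvg_cst | exact: uc].
have I := circle_continuous_integrable.
apply: complex_ext.
- rewrite complex_ReD complex_ReM /=.
  under eq_Rintegral do rewrite complex_ReD complex_ReM.
  rewrite RintegralD //; last 2 first.
  + apply: I => s; apply: cvgB; exact: Z.
  + exact: I.
  rewrite RintegralB //; try by apply: I; exact: Z.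
  by rewrite !RintegralZl //; exact: I.
- rewrite complex_ImD complex_ImM /=.
  under eq_Rintegral do rewrite complex_ImD complex_ImM.
  rewrite RintegralD //; last 2 first.
  + apply: I => s; apply: cvgD; exact: Z.
  + exact: I.
  rewrite RintegralD //; try by apply: I; exact: Z.
  by rewrite !RintegralZl //; exact: I.
Qed.

Lemma circle_diff_velocity c rho f : circle_diff c rho f ->
  forall t, exists dh,
    has_cderiv (fun t => f (circle_point c rho t) * ('i%C * rho%:C * expi t)) t dh.
Proof.
move=> fP t; have [df dfP] := fP t.
eexists; apply: has_cderivM dfP _.
by apply: has_cderivM; [exact: has_cderiv_cst | exact: has_cderiv_expi].
Qed.

Lemma contour_circle_linear c rho (a : R[i]) f g :
  circle_diff c rho f -> circle_diff c rho g ->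
  contour_circle (fun z => a * f z + g z) c rho =
  a * contour_circle f c rho + contour_circle g c rho.
Proof.
move=> /circle_diff_velocity fP /circle_diff_velocity gP.
rewrite !contour_circleE -cintegral_linear //; congr cintegral.
by apply/funext => t; ring.
Qed.

Lemma eq_contour_circle c rho f g :
  (forall t, f (circle_point c rho t) = g (circle_point c rho t)) ->
  contour_circle f c rho = contour_circle g c rho.
Proof.
by move=> fg; rewrite !contour_circleE; congr cintegral; apply/funext => t; rewrite fg.
Qed.

Lemma circle_point_2pi c rho : circle_point c rho (2 * pi) = circle_point c rho 0.
Proof.
rewrite /circle_point /expi.
have -> : 2 * pi = pi *+ 2 :> R by rewrite mulr_natl.
by rewrite cos2pi cos0 sin2pi sin0.
Qed.

Lemma Rintegral_derivative_periodic (F f : R -> R) : continuous f ->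
  (forall t, is_derive t (1 : R) F (f t)) -> F (2 * pi) = F 0 ->
  (\int[@lebesgue_measure R]_(t in `[0, 2 * pi]%classic) f t)%R = 0.
Proof.
move=> fc dF F0; rewrite /Rintegral (continuous_FTC2 (F := F)).
- by rewrite F0 subee.
- by rewrite mulr_gt0 // pi_gt0.
- exact: continuous_subspaceT.
- have Fc : continuous F.
    move=> t; apply: differentiable_continuous; apply/derivable1_diffP.
    by have dFt := dF t; exact: ex_derive.
  split; first by move=> t _; have dFt := dF t; exact: ex_derive.
  + by apply: cvg_at_right_filter; exact: Fc.
  + by apply: cvg_at_left_filter; exact: Fc.
- by move=> t _; rewrite derive1E; have := dF t => ?; rewrite derive_val.
Qed.

(** The fundamental theorem of calculus in each component. The end values agree because F is a
    function of the point and not of the parameter: this is where single-valuedness of a logarithm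
    on the loop enters. *)
Lemma contour_circle_primitive c rho F f :
  circle_diff c rho f -> circle_primitive c rho F f -> contour_circle f c rho = 0.
Proof.
move=> /circle_diff_velocity /continuous_has_cderiv[f1 f2] FP.
rewrite contour_circleE; apply: complex_ext => /=.
- apply: (Rintegral_derivative_periodic (F := fun s => complex.Re (F (circle_point c rho s)))).
  + exact: f1.
  + by move=> t; have [] := FP t.
  + by rewrite circle_point_2pi.
- apply: (Rintegral_derivative_periodic (F := fun s => complex.Im (F (circle_point c rho s)))).
  + exact: f2.
  + by move=> t; have [] := FP t.
  + by rewrite circle_point_2pi.
Qed.
End Contour.

(** * Elementary integrands: inverse powers and the logarithm *)

Section ContourElementary.
Variable R : realType.
Implicit Types (f g F : R[i] -> R[i]) (t rho : R) (c a : R[i]).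

Lemma circle_diff_cst c rho a : circle_diff c rho (fun=> a).
Proof. by move=> t; eexists; exact: has_cderiv_cst. Qed.

Lemma circle_diff_id c rho : circle_diff c rho id.
Proof. by move=> t; eexists; exact: has_cderiv_circle_point. Qed.

Lemma circle_diffD c rho f g :
  circle_diff c rho f -> circle_diff c rho g -> circle_diff c rho (fun z => f z + g z).
Proof.
move=> fP gP t; have [df dfP] := fP t; have [dg dgP] := gP t.
by eexists; exact: has_cderivD dfP dgP.
Qed.

Lemma circle_diffM c rho f g :
  circle_diff c rho f -> circle_diff c rho g -> circle_diff c rho (fun z => f z * g z).
Proof.
move=> fP gP t; have [df dfP] := fP t; have [dg dgP] := gP t.
by eexists; exact: has_cderivM dfP dgP.
Qed.

Lemma circle_diffV c rho f : (forall t, f (circle_point c rho t) != 0) ->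
  circle_diff c rho f -> circle_diff c rho (fun z => (f z)^-1).
Proof.
move=> f0 fP t; have [df dfP] := fP t.
by eexists; exact: has_cderivV (f0 t) dfP.
Qed.

Lemma circle_diff_exprz c rho f (k : int) : (forall t, f (circle_point c rho t) != 0) ->
  circle_diff c rho f -> circle_diff c rho (fun z => f z ^ k).
Proof.
move=> f0 fP t; have [df dfP] := fP t.
by eexists; exact: has_cderiv_exprz (f0 t) dfP.
Qed.

Lemma circle_diff_prod c rho (I : Type) (r : seq I) (F : I -> R[i] -> R[i]) :
  (forall i, circle_diff c rho (F i)) -> circle_diff c rho (fun z => \prod_(i <- r) F i z).
Proof.
move=> FP; elim: r => [|i r IH].
  have -> : (fun z => \prod_(i <- [::]) F i z) = fun=> 1.
    by apply/funext => s; rewrite big_nil.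
  exact: circle_diff_cst.
have -> : (fun z => \prod_(i <- i :: r) F i z) = fun z => F i z * \prod_(i <- r) F i z.
  by apply/funext => s; rewrite big_cons.
exact: circle_diffM.
Qed.

Lemma normc_expi t : Normc.normc (expi t) = 1.
Proof. by rewrite /= cos2Dsin2 sqrtr1. Qed.

Lemma expi_neq0 t : expi t != 0.
Proof.
by apply/eqP => e; have := normc_expi t; rewrite e Normc.normc0 => /esym/eqP; rewrite oner_eq0.
Qed.

Lemma normc_circle_point c rho t : 0 < rho ->
  Normc.normc (circle_point c rho t - c) = rho.
Proof.
move=> r0; rewrite /circle_point addrC addKr Normc.normcM normc_expi mulr1 /=.
by rewrite expr0n /= addr0 sqrtr_sqr gtr0_norm.
Qed.

Lemma Re_gt0_near1 (w : R[i]) : Normc.normc (w - 1) < 1 -> 0 < complex.Re w.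
Proof.
case: w => a b /= h.
have : `|a - 1| < 1.
  apply: le_lt_trans h; rewrite -sqrtr_sqr; apply: ler_wsqrtr.
  by rewrite lerDl sqr_ge0.
by rewrite ltr_norml; lra.
Qed.

(** The ratio is at distance rho / |c - a| < 1 from 1. Dividing by c - a thus moves the circle into
    the half-plane where [plog] is a logarithm. *)
Lemma Re_circle_ratio_gt0 c a rho t : 0 < rho -> rho < Normc.normc (c - a) ->
  0 < complex.Re ((circle_point c rho t - a) / (c - a)).
Proof.
move=> r0 ra; apply: Re_gt0_near1.
have ca : c - a != 0.
  by apply/eqP => e; move: ra; rewrite e Normc.normc0 ltNge ltW.
have -> : (circle_point c rho t - a) / (c - a) - 1 = (circle_point c rho t - c) / (c - a).
  by field.
rewrite Normc.normcM Normc.normcV normc_circle_point //.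
by rewrite ltr_pdivrMr ?mul1r // (lt_trans r0).
Qed.

Lemma circle_point_neq_outside c a rho t : 0 < rho -> rho < Normc.normc (c - a) ->
  circle_point c rho t - a != 0.
Proof.
move=> r0 ra; have := Re_circle_ratio_gt0 t r0 ra.
by apply: contraTneq => ->; rewrite mul0r ltxx.
Qed.

Lemma circle_point_neq_center c rho t : 0 < rho -> circle_point c rho t - c != 0.
Proof.
move=> r0; apply/eqP => e; have := normc_circle_point c t r0.
by rewrite e Normc.normc0 => /eqP; rewrite lt_eqF.
Qed.

Lemma circle_diff_inv c rho a : (forall t, circle_point c rho t - a != 0) ->
  circle_diff c rho (fun z => (z - a)^-1).
Proof.
move=> a0; apply: circle_diffV => //.
by apply: circle_diffD; [exact: circle_diff_id | exact: circle_diff_cst].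
Qed.

Lemma has_cderiv_circle_sub c rho a t :
  has_cderiv (fun s => circle_point c rho s - a) t ('i%C * rho%:C * expi t).
Proof.
have := has_cderivD (has_cderiv_circle_point c rho t) (has_cderiv_cst (- a) t).
by rewrite addr0.
Qed.

Lemma contour_inv_outside c a rho : 0 < rho -> rho < Normc.normc (c - a) ->
  contour_circle (fun z => (z - a)^-1) c rho = 0.
Proof.
move=> r0 ra; have za t := circle_point_neq_outside t r0 ra.
have ca : c - a != 0.
  by apply/eqP => e; move: ra; rewrite e Normc.normc0 ltNge ltW.
apply: (contour_circle_primitive (F := fun z => plog ((z - a) / (c - a)))).
  exact: circle_diff_inv.
move=> t; have := has_cderiv_plog (Re_circle_ratio_gt0 t r0 ra)
  (has_cderivM (has_cderiv_circle_sub c rho a t) (has_cderiv_cst (c - a)^-1 t)).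
move=> /has_cderiv_eq; apply; field.
by rewrite za ca.
Qed.

Lemma contour_inv_center c rho : 0 < rho ->
  contour_circle (fun z => (z - c)^-1) c rho = 2 * pi%:C * 'i%C.
Proof.
move=> r0; rewrite contour_circleE.
have -> : (fun t => (circle_point c rho t - c)^-1 * ('i%C * rho%:C * expi t)) = fun=> 'i%C.
  apply/funext => t; have := circle_point_neq_center c t r0.
  rewrite /circle_point [c + _]addrC addrK mulf_eq0 negb_or => /andP[h1 h2]; field.
  by rewrite h1 h2.
apply: complex_ext; rewrite /= ?complex_ReM ?complex_ImM /=.
  by rewrite Rintegral_cst //= mul0r; ring.
rewrite Rintegral_cst //= lebesgue_measure_itv /= lte_fin mulr_gt0 ?pi_gt0 //=.
ring.
Qed.

Lemma has_cderiv_log_branch (gam rho t : R) : 0 < rho -> rho < 1 ->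
  has_cderiv (fun s => log_branch gam (circle_point (expi gam) rho s)) t
    ((circle_point (expi gam) rho t)^-1 * ('i%C * rho%:C * expi t)).
Proof.
move=> r0 r1; have ra : rho < Normc.normc (expi gam - 0) by rewrite subr0 normc_expi.
have := Re_circle_ratio_gt0 t r0 ra; rewrite !subr0 => re0.
have := circle_point_neq_outside t r0 ra; rewrite subr0 => z0.
have := has_cderivD (has_cderiv_cst ('i%C * gam%:C) t) (has_cderiv_plog re0
  (has_cderivM (has_cderiv_circle_point (expi gam) rho t) (has_cderiv_cst (expi gam)^-1 t))).
move=> /has_cderiv_eq; apply; field.
by rewrite z0 expi_neq0.
Qed.

(** Exponents at least 2 admit a primitive on every circle missing a, even when a lies inside; this
    disposes of multiple poles. *)
Lemma circle_primitive_inv_exp c a rho (k : nat) : (forall t, circle_point c rho t - a != 0) ->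
  circle_primitive c rho (fun z => - k.+1%:R^-1 * (z - a) ^- k.+1) (fun z => (z - a) ^- k.+2).
Proof.
move=> za t; have k0 : k.+1%:R != 0 :> R[i] by rewrite pnatr_eq0.
have := has_cderivM (has_cderiv_cst (- k.+1%:R^-1) t)
  (has_cderiv_exprz (- k.+1%:Z) (za t) (has_cderiv_circle_sub c rho a t)).
move=> /has_cderiv_eq; apply.
rewrite mulrNz /= -exprnN !exprS -pmulrn; move: k0 (za t).
move: (_ - a) (k.+1%:R) => w x x0 w0; field.
by rewrite x0 w0 expf_neq0.
Qed.
End ContourElementary.

(** * Sums of residues of products of Cayley factors *)

Section TotalResidue.
Variables (R : realType) (I : finType) (c : I -> R[i]) (rho : R).
Hypothesis rho_gt0 : 0 < rho.
Hypothesis separated : forall j k, j != k -> rho < Normc.normc (c k - c j).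
Hypothesis away_from_zero : forall k, rho < Normc.normc (c k).
Implicit Types (f g : R[i] -> R[i]) (s u : seq I).

Definition total_contour f := \sum_k contour_circle f (c k) rho.

Let regular f := forall k, circle_diff (c k) rho f.

Lemma total_contour_linear (a : R[i]) f g : regular f -> regular g ->
  total_contour (fun z => a * f z + g z) = a * total_contour f + total_contour g.
Proof.
move=> fP gP; rewrite /total_contour mulr_sumr -big_split /=.
by apply: eq_bigr => k _; apply: contour_circle_linear.
Qed.

Lemma eq_total_contour f g :
  (forall k t, f (circle_point (c k) rho t) = g (circle_point (c k) rho t)) ->
  total_contour f = total_contour g.
Proof. by move=> fg; apply: eq_bigr => k _; apply: eq_contour_circle. Qed.

Lemma total_contour_comb (a b : R[i]) f g : regular f -> regular g ->
  total_contour (fun z => a * f z + b * g z) = a * total_contour f + b * total_contour g.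
Proof.
move=> fP gP; have reg0 : regular (fun=> 0) by move=> k; exact: circle_diff_cst.
have T0 : total_contour (fun=> 0) = 0.
  (* For the zero function, linearity with coefficient 1 reads T = T + T. *)
  have := total_contour_linear 1 reg0 reg0.
  rewrite (@eq_total_contour _ (fun=> 0)); last by move=> k t; rewrite mulr0 addr0.
  by rewrite mul1r => /eqP; rewrite -subr_eq subrr eq_sym => /eqP.
rewrite total_contour_linear //; last first.
  by move=> k; apply: circle_diffM; [exact: circle_diff_cst | exact: gP].
congr (_ + _); rewrite -[RHS]addr0 -T0 -total_contour_linear //.
by apply: eq_total_contour => k t; rewrite addr0.
Qed.

Lemma circle_point_neq_pole (j k : I) (t : R) : circle_point (c k) rho t - c j != 0.
Proof.
have [->|jk] := eqVneq j k; first exact: circle_point_neq_center.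
exact/circle_point_neq_outside/separated.
Qed.

Lemma circle_point_neq0 (k : I) (t : R) : circle_point (c k) rho t != 0.
Proof.
rewrite -[X in X != _]subr0.
by apply: circle_point_neq_outside => //; rewrite subr0.
Qed.

Lemma total_contour_pole (j : I) :
  total_contour (fun z => (z - c j)^-1) = 2 * pi%:C * 'i%C.
Proof.
rewrite /total_contour (bigD1 j) //= contour_inv_center // big1 ?addr0 // => k kj.
by apply: contour_inv_outside => //; apply: separated; rewrite eq_sym.
Qed.

Lemma total_contour_inv : total_contour (fun z => z^-1) = 0.
Proof.
rewrite /total_contour big1 // => k _.
have := @contour_inv_outside R (c k) 0 rho rho_gt0; rewrite subr0 => /(_ (away_from_zero k)) <-.
by apply: eq_contour_circle => t; rewrite subr0.
Qed.

(** Multiplicities are encoded by repetitions in the list s, which reduces statements on exponents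
    to inductions on lists. *)
Let poles s (z : R[i]) := \prod_(j <- s) (z - c j)^-1.
Let cayley s (z : R[i]) := \prod_(j <- s) ((z + c j) / (z - c j)).

Lemma regular_poles s : regular (poles s).
Proof.
move=> k; apply: circle_diff_prod => j; apply: circle_diff_inv => t.
exact: circle_point_neq_pole.
Qed.

Lemma regular_cayley s : regular (cayley s).
Proof.
move=> k; apply: circle_diff_prod => j; apply: circle_diffM.
  by apply: circle_diffD; [exact: circle_diff_id | exact: circle_diff_cst].
by apply: circle_diff_inv => t; exact: circle_point_neq_pole.
Qed.

Lemma poles_cons j s z : poles (j :: s) z = (z - c j)^-1 * poles s z.
Proof. exact: big_cons. Qed.

Lemma cayley_cons j s z : cayley (j :: s) z = (z + c j) / (z - c j) * cayley s z.
Proof. exact: big_cons. Qed.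

(* Two distinct simple poles are split by partial fractions, which lowers the
   number of factors; a single multiple pole has a primitive. *)
Lemma total_contour_poles_eq0 s : (1 < size s)%N -> total_contour (poles s) = 0.
Proof.
(* The induction runs over a bound for the size, since the shorter lists produced by partial
   fractions are not tails of s. *)
move: {2}(size s) (leqnn (size s)) => n; elim: n s => [|n IH] [|j [|i0 s]] //= sn _.
have [/allP all_j | /allPn[i i_s ij]] := boolP (all (pred1 j) (i0 :: s)).
  have -> : total_contour (poles (j :: i0 :: s)) =
            total_contour (fun z => (z - c j) ^- (size s).+2).
    apply: eq_total_contour => k t; rewrite poles_cons /poles.
    rewrite (eq_big_seq (fun=> (circle_point (c k) rho t - c j)^-1)).
      by rewrite big_const_seq count_predT iter_mulr_1 /= -exprS exprVn.
    by move=> l /all_j /eqP ->.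
  apply: big1 => k _.
  have nz t := circle_point_neq_pole j k t.
  apply: contour_circle_primitive (circle_primitive_inv_exp _ nz).
  apply: circle_diffV => [t|]; first by rewrite expf_neq0.
  apply: (@circle_diff_exprz _ _ _ (fun z => z - c j) (size s).+2%:Z) => //.
  by apply: circle_diffD; [exact: circle_diff_id | exact: circle_diff_cst].
have ji : c j - c i != 0.
  apply/eqP => e; have := separated ij; rewrite e Normc.normc0.
  by rewrite ltNge ltW.
set r := rem i (i0 :: s).
have pE z : poles (j :: i0 :: s) z = (z - c j)^-1 * ((z - c i)^-1 * poles r z).
  rewrite poles_cons; congr (_ * _); rewrite /poles.
  by rewrite (perm_big _ (perm_to_rem i_s)) big_cons.
have sz : size (i0 :: s) = (size r).+1 by rewrite (perm_size (perm_to_rem i_s)).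
transitivity (total_contour (fun z => (c j - c i)^-1 * poles (j :: r) z +
   - (c j - c i)^-1 * poles (i :: r) z)).
  apply: eq_total_contour => k t; rewrite pE !poles_cons.
  have h1 := circle_point_neq_pole j k t; have h2 := circle_point_neq_pole i k t.
  by field; rewrite h1 h2 ji.
rewrite total_contour_comb //; [|exact: regular_poles|exact: regular_poles].
(* With just two distinct simple poles, the split leaves two integrals equal to 2 pi i with opposite
   coefficients. *)
have [r0|r_gt0] := posnP (size r).
  have -> : r = [::] by apply: size0nil.
  have one k : total_contour (poles [:: k]) = 2 * pi%:C * 'i%C.
    by rewrite -(total_contour_pole k); apply: eq_total_contour => l t; rewrite /poles big_seq1.
  by rewrite !one; ring.
by rewrite !IH ?mulr0 ?addr0 //=; move: sn sz r_gt0 => /=; lia.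
Qed.

Lemma cayley_factor (z a : R[i]) : z - a != 0 -> (z + a) / (z - a) = 1 + 2 * a / (z - a).
Proof. by move=> h; field. Qed.

(** A Cayley factor is 1 + 2c / (z - c). The second summand lengthens the list of poles to at least
    two, where the integral vanishes; each factor may thus be replaced by its value 1 at infinity.
    The list u is kept general because the induction extends it. *)
Lemma total_contour_cayley_poles s u : (0 < size u)%N ->
  total_contour (fun z => cayley s z * poles u z) = total_contour (poles u).
Proof.
elim: s u => [|j s IH] u u0.
  by apply: eq_total_contour => k t; rewrite /cayley big_nil mul1r.
transitivity (total_contour (fun z =>
    2 * c j * (cayley s z * poles (j :: u) z) + cayley s z * poles u z)).
  apply: eq_total_contour => k t; rewrite cayley_cons poles_cons.
  by rewrite cayley_factor ?circle_point_neq_pole //; ring.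
rewrite total_contour_linear; last 2 first.
- by move=> k; apply: circle_diffM; [exact: regular_cayley | exact: regular_poles].
- by move=> k; apply: circle_diffM; [exact: regular_cayley | exact: regular_poles].
by rewrite !IH //= total_contour_poles_eq0 ?mulr0 ?add0r.
Qed.

(** Since (z + c) / (z (z - c)) = 2 / (z - c) - 1 / z, a further factor turns the value x, in units
    of 2 pi i, into 2 - x; starting from 0 this alternates between 0 and 2. *)
Lemma total_contour_cayley s :
  total_contour (fun z => z^-1 * \prod_(j <- s) ((z + c j) / (z - c j))) =
  2 * pi%:C * 'i%C * (1 - (-1) ^+ size s).
Proof.
rewrite -/(cayley s); elim: s => [|j s IH].
  rewrite subrr mulr0 -total_contour_inv.
  by apply: eq_total_contour => k t; rewrite big_nil mulr1.
have regI : regular (fun z => z^-1).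
  move=> k; apply: circle_diffV; last exact: circle_diff_id.
  by move=> t; exact: circle_point_neq0.
have reg1 : regular (fun z => z^-1 * cayley s z).
  by move=> k; apply: circle_diffM; [exact: regI | exact: regular_cayley].
have reg2 : regular (fun z => cayley s z * poles [:: j] z).
  by move=> k; apply: circle_diffM; [exact: regular_cayley | exact: regular_poles].
transitivity (total_contour (fun z =>
    2 * (cayley s z * poles [:: j] z) + - 1 * (z^-1 * cayley s z))).
  apply: eq_total_contour => k t; rewrite -/(cayley _ _) cayley_cons /poles big_seq1.
  have h1 := circle_point_neq_pole j k t; have h2 := circle_point_neq0 k t.
  by field; rewrite h1 h2.
rewrite total_contour_comb //.
rewrite total_contour_cayley_poles // IH.
have -> : total_contour (poles [:: j]) = 2 * pi%:C * 'i%C.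
  by rewrite -(total_contour_pole j); apply: eq_total_contour => l t; rewrite /poles big_seq1.
by rewrite /= exprS; ring.
Qed.
End TotalResidue.

(** * Unit vectors, coefficients and windows of d consecutive indices *)

Section Lattice.
Variable d : nat.
Implicit Types (r m : int) (n : 'rV[int]_d).

Lemma unit_vecD r : unit_vec d (r + d%:Z) = - unit_vec d r.
Proof.
apply/rowP => i; rewrite !mxE opprB.
have -> : r + d%:Z - (i.+1 + d)%N%:Z = r - i.+1%:Z by lia.
have -> : r + d%:Z - i.+1%:Z = r - (i.+1 + d)%N%:Z + (2 * d)%N%:Z by lia.
by rewrite rpredDr ?dvdzz.
Qed.

Lemma coef_add r n n' : coef r (n + n') = coef r n + coef r n'.
Proof.
by rewrite /coef -big_split /=; apply: eq_bigr => i _; rewrite mxE mulrDl.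
Qed.

Lemma coef_shift r n : coef (r + d%:Z) n = - coef r n.
Proof.
by rewrite /coef -sumrN; apply: eq_bigr => i _; rewrite unit_vecD mxE mulrN.
Qed.

Lemma coef_unit_vec m (j k : 'I_d) :
  coef (m + k%:Z) (unit_vec d (m + j%:Z)) = (j == k)%:Z.
Proof.
have := coef_octant m (fun l : 'I_d => (j == l) : nat) k.
rewrite (bigD1 j) //= eqxx mulr1n big1 ?addr0 // => l.
by rewrite eq_sym => /negPf ->; rewrite mulr0n.
Qed.

Lemma unit_vec_std (l i : 'I_d) : unit_vec d l.+1%:Z 0 i = (l == i)%:Z.
Proof.
rewrite mxE -val_eqE /=; have := ltn_ord l; have := ltn_ord i.
move: (nat_of_ord l) (nat_of_ord i) => {l} {}i l li ll.
have d0 : (0 < d)%N by lia.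
have -> : ((2 * d)%N%:Z %| i.+1%:Z - (l.+1 + d)%N%:Z)%Z = false.
  apply/negP => /dvdzP[q e]; have [q0|q0] : (0 <= q \/ q <= -1) by lia.
    nia.
  nia.
have -> : ((2 * d)%N%:Z %| i.+1%:Z - l.+1%:Z)%Z = (i == l).
  apply/idP/eqP => [/dvdzP[q e]|->]; last by rewrite subrr dvdz0.
  have [q0|[q0|q0]] : (q = 0 \/ (1 <= q \/ q <= -1)) by lia.
  - by move: e; rewrite q0; lia.
  - nia.
  - nia.
by rewrite subr0.
Qed.

Lemma coef_std (l : 'I_d) n : coef l.+1%:Z n = n 0 l.
Proof.
rewrite /coef (bigD1 l) //= unit_vec_std eqxx mulr1 big1 ?addr0 // => i il.
by rewrite unit_vec_std eq_sym (negPf il) mulr0.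
Qed.

(** Moving the window by one step trades G(k) for the equal value G(k + d). The operation is left
    general: the constraint needs both a sum and a product of signs. *)
Lemma big_int_window (T : Type) (idx : T) (op : Monoid.com_law idx) (G : int -> T) m :
  (forall r, G (r + d%:Z) = G r) ->
  \big[op/idx]_(j < d) G (m + j%:Z) = \big[op/idx]_(j < d) G (1 + j%:Z).
Proof.
move=> GP.
have step k : \big[op/idx]_(j < d) G (k + j%:Z) = \big[op/idx]_(j < d) G (k + 1 + j%:Z).
  case: d GP => [|d'] GP; first by rewrite !big_ord0.
  rewrite big_ord_recl big_ord_recr /= [RHS]Monoid.mulmC; congr (op _ _).
    by rewrite addr0 -(GP k); congr G; lia.
  by apply: eq_bigr => j _; congr G; rewrite /bump /=; lia.
have up (k : int) (p : nat) :
    \big[op/idx]_(j < d) G (k + j%:Z) = \big[op/idx]_(j < d) G (k + p%:Z + j%:Z).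
  elim: p => [|p IH]; first by rewrite addr0.
  by rewrite IH step -addrA -PoszD addn1.
have [h|h] : 1 <= m \/ m <= 1 by lia.
  have e : m = 1 + `|m - 1|%N%:Z by lia.
  by rewrite {1}e -up.
have e : 1 = m + `|1 - m|%N%:Z by lia.
by rewrite [in RHS]e -up.
Qed.

Lemma octant1 n : orthant n -> octant 1 n.
Proof.
move=> n0; exists (fun i => `|n 0%R i|%N); apply/rowP => i.
rewrite summxE (bigD1 i) //= big1 => [|j ji].
  by rewrite mulmxnE -intS unit_vec_std eqxx addr0 natz gez0_abs.
by rewrite mulmxnE -intS unit_vec_std (negPf ji) mul0rn.
Qed.
End Lattice.

(** * Distinctness of the directions *)

Section Directions.
Variables (R : realType) (d : nat) (theta : int -> R[i]) (gamma : int -> R).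
Hypothesis theta_gamma : directions d theta gamma.

(** Equality would give cos (y - x) = 1, whereas 1 - cos (y - x) is twice the square of sin ((y - x)
    / 2), which is positive on the given range. *)
Lemma expi_inj_lt (x y : R) : x < y -> y < x + 2 * pi -> expi x != expi y.
Proof.
move=> xy yx; apply/eqP => -[ec es].
have s0 : 0 < sin ((y - x) / 2) by apply: sin_gt0_pi; apply/andP; split; lra.
have : cos (y - x) = 1 by rewrite cosB ec es -!expr2 cos2Dsin2.
have -> : y - x = (y - x) / 2 + (y - x) / 2 by field.
rewrite cosD; have := cos2Dsin2 ((y - x) / 2); nra.
Qed.

Lemma theta_periodic (r q : int) : theta (r + q * (2 * d)%N%:Z) = theta r.
Proof.
have [th _ _ _] := theta_gamma.
have p1 s : theta (s + (2 * d)%N%:Z) = theta s.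
  have -> : s + (2 * d)%N%:Z = s + d%:Z + d%:Z by lia.
  by rewrite !th opprK.
have pn s (p : nat) : theta (s + p%:Z * (2 * d)%N%:Z) = theta s.
  elim: p => [|p IH]; first by rewrite mul0r addr0.
  by rewrite -IH -[RHS]p1; congr theta; lia.
have [h|h] : 0 <= q \/ q <= 0 by lia.
  by rewrite -[q]gez0_abs.
rewrite -(pn _ `|q|%N); congr theta.
have -> : `|q|%N%:Z = - q by lia.
lia.
Qed.

Lemma theta_inj (d_gt0 : (0 < d)%N) (r s : int) : theta r = theta s -> ((2 * d)%N%:Z %| r - s)%Z.
Proof.
have [_ [alpha [ta lt_a]] _ _] := theta_gamma.
have inj (i j : nat) : (i < 2 * d)%N -> (j < 2 * d)%N -> theta i.+1%:Z = theta j.+1%:Z -> i = j.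
  move=> id jd; rewrite !ta // => e.
  have [ij|ij|//] := ltngtP i j.
    by have /andP[h1 h2] := lt_a i j ltac:(lia); move/eqP: e; rewrite (negPf (expi_inj_lt h1 h2)).
  by have /andP[h1 h2] := lt_a j i ltac:(lia); move/eqP: e; rewrite eq_sym (negPf (expi_inj_lt h1 h2)).
have D0 : (2 * d)%N%:Z != 0 by lia.
(* The circular order separates only theta_1, ..., theta_2d, so indices are first reduced modulo 2d;
   the shift by 1 makes the representatives run from 1 to 2d. *)
have std (k : int) : exists2 i : nat, (i < 2 * d)%N &
    exists q : int, k = i.+1%:Z + q * (2 * d)%N%:Z.
  have m0 := modz_ge0 (k - 1) D0.
  have m1 := ltz_pmod (k - 1) (ltac:(lia) : 0 < (2 * d)%N%:Z).
  exists `|((k - 1) %% (2 * d)%N%:Z)%Z|%N; first by lia.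
  exists ((k - 1) %/ (2 * d)%N%:Z)%Z.
  by have := divz_eq (k - 1) (2 * d)%N%:Z; lia.
have [i id [p ->]] := std r; have [j jd [q ->]] := std s.
rewrite !theta_periodic => /(inj _ _ id jd) ->.
by apply/dvdzP; exists (p - q); lia.
Qed.
End Directions.

Lemma circle_diff_sum (R : realType) (c : R[i]) (rho : R) (I : Type) (r : seq I)
    (a : I -> R[i]) (f : I -> R[i] -> R[i]) :
  (forall i, circle_diff c rho (f i)) ->
  circle_diff c rho (fun z => \sum_(i <- r) a i * f i z).
Proof.
move=> fP; elim: r => [|i r IH].
  have -> : (fun z => \sum_(i <- [::]) a i * f i z) = fun=> 0.
    by apply/funext => z; rewrite big_nil.
  exact: circle_diff_cst.
have -> : (fun z => \sum_(j <- i :: r) a j * f j z) =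
    fun z => a i * f i z + \sum_(j <- r) a j * f j z.
  by apply/funext => z; rewrite big_cons.
by apply: circle_diffD => //; apply: circle_diffM; first exact: circle_diff_cst.
Qed.

Lemma contour_circle_sum (R : realType) (c : R[i]) (rho : R) (I : Type) (r : seq I)
    (a : I -> R[i]) (f : I -> R[i] -> R[i]) :
  (forall i, circle_diff c rho (f i)) ->
  contour_circle (fun z => \sum_(i <- r) a i * f i z) c rho =
  \sum_(i <- r) a i * contour_circle (f i) c rho.
Proof.
move=> fP; elim: r => [|i r IH].
  rewrite big_nil.
  apply: (contour_circle_primitive (F := fun=> 0) (circle_diff_sum [::] a fP)) => t.
  by rewrite big_nil mul0r; exact: has_cderiv_cst.
rewrite big_cons -IH -contour_circle_linear //; last exact: circle_diff_sum.
by apply: eq_contour_circle => t; rewrite big_cons.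
Qed.

Section LinearRelation.
Variables (R : realType) (a b : R[i]).

(** The Cauchy-Riemann relation is linear in the four values, so it may be checked loop by loop and
    then summed and normalised. *)
Lemma linear_relation_scale (x w1 w2 w3 w4 : R[i]) : a * (w1 - w2) = b * (w3 - w4) ->
  a * (x * w1 - x * w2) = b * (x * w3 - x * w4).
Proof. by rewrite -!mulrBr mulrCA => ->; rewrite mulrCA. Qed.

Lemma linear_relation_sum (I : finType) (w1 w2 w3 w4 : I -> R[i]) :
  (forall i, a * (w1 i - w2 i) = b * (w3 i - w4 i)) ->
  a * (\sum_i w1 i - \sum_i w2 i) = b * (\sum_i w3 i - \sum_i w4 i).
Proof. by move=> h; rewrite -!sumrB !mulr_sumr; apply: eq_bigr. Qed.

(** The hypothesis has the shape in which [contour_circle_sum] unfolds over four terms. *)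
Lemma linear_relation_of_eq0 (w1 w2 w3 w4 : R[i]) :
  0 = a * w1 + (- a * w2 + (- b * w3 + (b * w4 + 0))) ->
  a * (w1 - w2) = b * (w3 - w4).
Proof. by move=> e; apply/eqP; rewrite -subr_eq0; apply/eqP; rewrite e; ring. Qed.
End LinearRelation.

(** * Cauchy-Riemann equations and constraint for the discrete logarithm *)

Section DiscreteLogarithm.
Variables (R : realType) (d : nat) (theta : int -> R[i]) (gamma : int -> R) (rho : R).
Hypothesis d_gt0 : (0 < d)%N.
Hypothesis theta_gamma : directions d theta gamma.
Hypothesis rho_small : small_radius theta rho.
Variable m : int.
Implicit Types (n : 'rV[int]_d) (j k l : 'I_d) (z : R[i]).

Let rho_gt0 : 0 < rho. Proof. by have [] := rho_small. Qed.
Let rho_lt1 : rho < 1. Proof. by have [] := rho_small. Qed.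

Let c k := theta (m + k%:Z).
Let log_at k := log_branch (gamma (m + k%:Z)).

(** The discrete exponential function in the coordinates of the octant S_m; integer powers are
    needed because n - e_j may leave the octant. *)
Definition wave n z : R[i] :=
  \prod_(j < d) ((z + theta (m + j%:Z)) / (z - theta (m + j%:Z))) ^ coef (m + j%:Z) n.

Definition ell_integrand k n z : R[i] :=
  log_branch (gamma (m + k%:Z)) z / (2 * z) * wave n z.

Lemma directions_separated j k : j != k -> rho < Normc.normc (c k - c j).
Proof.
have [_ _ sep] := rho_small; move=> jk; apply: sep; apply/eqP.
move=> /(theta_inj theta_gamma d_gt0) /dvdzP[q e].
have := ltn_ord j; have := ltn_ord k; move: jk; rewrite -val_eqE /=.
move: e; move: (nat_of_ord j) (nat_of_ord k) => a b e ab ad bd.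
have [q0|[q0|q0]] : (q = 0 \/ (1 <= q \/ q <= -1)) by lia.
- by move: e; rewrite q0; lia.
- nia.
- nia.
Qed.

(** The point - c_j is theta at m + j + d, and k - j - d lies strictly between - 2d and 0, so it is
    no multiple of 2d. *)
Lemma directions_separated_opp j k : rho < Normc.normc (c k - - c j).
Proof.
have [_ _ sep] := rho_small; have [th _ _ _] := theta_gamma.
rewrite /c -th; apply: sep; apply/eqP.
move=> /(theta_inj theta_gamma d_gt0) /dvdzP[q e].
have := ltn_ord j; have := ltn_ord k.
move: e; move: (nat_of_ord j) (nat_of_ord k) => a b e ad bd.
have [q0|q0] : (0 <= q \/ q <= -1) by lia.
- nia.
- nia.
Qed.

Lemma normc_theta (r : int) : Normc.normc (theta r) = 1.
Proof. by have [_ _ -> _] := theta_gamma; rewrite normc_expi. Qed.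

Let on_circle k z := exists t, z = circle_point (c k) rho t.

(** These are all the possible poles of the integrands: 0 from the factor 1 / (2z), c_j from
    positive exponents and - c_j from negative ones. *)
Lemma on_circle_neq k z : on_circle k z ->
  [/\ z != 0, forall j, z - c j != 0 & forall j, z + c j != 0].
Proof.
move=> [t ->]; split=> [|j|j].
- rewrite -[X in X != _]subr0; apply: circle_point_neq_outside => //.
  by rewrite subr0 normc_theta.
- have [->|jk] := eqVneq j k; first exact: circle_point_neq_center.
  exact/circle_point_neq_outside/directions_separated.
- rewrite -[X in _ + X]opprK.
  exact/circle_point_neq_outside/directions_separated_opp.
Qed.

Lemma wave_add n k j z : on_circle k z ->
  wave (n + unit_vec d (m + j%:Z)) z = (z + c j) / (z - c j) * wave n z.
Proof.
move=> /on_circle_neq[_ h1 h2]; rewrite /wave (bigD1 j) //= [in RHS](bigD1 j) //= mulrA.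
congr (_ * _).
  rewrite coef_add coef_unit_vec eqxx expfzDr; first by rewrite expr1z mulrC.
  by apply: mulf_neq0; rewrite ?invr_eq0; [exact: h2 | exact: h1].
apply: eq_bigr => l lj; rewrite coef_add coef_unit_vec eq_sym (negPf lj) addr0 //.
Qed.

Lemma wave_sub n k j z : on_circle k z ->
  wave (n - unit_vec d (m + j%:Z)) z = (z - c j) / (z + c j) * wave n z.
Proof.
move=> kz; have [_ h1 h2] := on_circle_neq kz.
rewrite -[in RHS](subrK (unit_vec d (m + j%:Z)) n) (wave_add _ _ kz).
by field; rewrite h1 h2.
Qed.

Definition ell_contour n : R[i] :=
  \sum_(k < d) contour_circle (ell_integrand k n) (theta (m + k%:Z)) rho.

Lemma wave_factor_neq0 k j (t : R) :
  (circle_point (c k) rho t + c j) / (circle_point (c k) rho t - c j) != 0.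
Proof.
have [_ h1 h2] := on_circle_neq (ex_intro _ t erefl : on_circle k _).
by rewrite mulf_neq0 ?invr_eq0.
Qed.

Lemma circle_diff_wave_factor k j : circle_diff (c k) rho (fun z => (z + c j) / (z - c j)).
Proof.
apply: circle_diffM.
  by apply: circle_diffD; [exact: circle_diff_id | exact: circle_diff_cst].
apply: circle_diff_inv => t.
by have [_ h1 h2] := on_circle_neq (ex_intro _ t erefl : on_circle k _).
Qed.

Lemma circle_diff_wave k n : circle_diff (c k) rho (wave n).
Proof.
apply: circle_diff_prod => j; apply: circle_diff_exprz; first exact: wave_factor_neq0.
exact: circle_diff_wave_factor.
Qed.

Lemma has_cderiv_log_at k (t : R) :
  has_cderiv (fun s => log_at k (circle_point (c k) rho s)) t
    ((circle_point (c k) rho t)^-1 * ('i%C * rho%:C * expi t)).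
Proof.
have [_ _ te _] := theta_gamma; rewrite /c te /log_at.
exact: has_cderiv_log_branch.
Qed.

Lemma circle_diff_inv0 k : circle_diff (c k) rho (fun z => z^-1).
Proof.
apply: circle_diffV; last exact: circle_diff_id.
by move=> t; have [] := on_circle_neq (ex_intro _ t erefl : on_circle k _).
Qed.

Lemma circle_diff_ell_integrand k n : circle_diff (c k) rho (ell_integrand k n).
Proof.
apply: circle_diffM; last exact: circle_diff_wave.
apply: circle_diffM; first by move=> t; eexists; exact: has_cderiv_log_at.
apply: circle_diffV; last first.
  by apply: circle_diffM; [exact: circle_diff_cst | exact: circle_diff_id].
move=> t; have [z0 _ _] := on_circle_neq (ex_intro _ t erefl : on_circle k _).
by rewrite mulf_neq0 ?pnatr_eq0.
Qed.

(** For x = (z + a) / (z - a) and y = (z + b) / (z - b), both (a - b)(xy - 1) and (a + b)(x - y)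
    equal 2z (a^2 - b^2) / ((z - a)(z - b)). *)
Lemma ell_CR n j k :
  let ell_m := ell theta gamma rho m in
  let ej := unit_vec d (m + j%:Z) in let ek := unit_vec d (m + k%:Z) in
  (c j - c k) * (ell_m (n + ej + ek) - ell_m n) =
  (c j + c k) * (ell_m (n + ej) - ell_m (n + ek)).
Proof.
move=> ell_m ej ek; apply: linear_relation_scale; apply: linear_relation_sum => l.
pose a (i : 'I_4) := nth 0 [:: c j - c k; - (c j - c k); - (c j + c k); c j + c k] i.
pose p (i : 'I_4) := nth n [:: n + ej + ek; n; n + ej; n + ek] i.
have := contour_circle_sum (index_enum 'I_4) a
  (fun i => circle_diff_ell_integrand l (p i)).
rewrite !big_ord_recl !big_ord0 /a /p /=.
set C0 := contour_circle (fun z => _) _ _.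
suff -> : C0 = 0 by exact: linear_relation_of_eq0.
rewrite /C0.
(* The empty sum serves to evaluate the integral of the zero function. *)
have zero := contour_circle_sum [::] (fun i : 'I_4 => 0)
  (fun i : 'I_4 => circle_diff_ell_integrand l (p i)).
rewrite big_nil in zero; rewrite -[RHS]zero.
apply: eq_contour_circle => t; rewrite big_nil.
have lz : on_circle l (circle_point (c l) rho t) by exists t.
have [z0 h1 h2] := on_circle_neq lz.
rewrite /ell_integrand !big_ord_recl big_ord0 /= !(wave_add _ _ lz) //.
have hj := h1 j; have hk := h1 k.
by field; rewrite z0 hj hk.
Qed.

(* The integrand of the constraint minus [wave n z / z] is the derivative of
   [- log z * wave n z]. *)
Lemma contour_constraint k n :
  \sum_(j < d) (coef (m + j%:Z) n)%:~R *
     contour_circle (ell_integrand k (n + unit_vec d (m + j%:Z))) (c k) rho +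
  \sum_(j < d) - (coef (m + j%:Z) n)%:~R *
     contour_circle (ell_integrand k (n - unit_vec d (m + j%:Z))) (c k) rho =
  contour_circle (fun z => z^-1 * wave n z) (c k) rho.
Proof.
have dI n' := circle_diff_ell_integrand k n'.
have dW : circle_diff (c k) rho (fun z => z^-1 * wave n z).
  by apply: circle_diffM; [exact: circle_diff_inv0 | exact: circle_diff_wave].
rewrite -(contour_circle_sum _ _ (fun j => dI _)) -(contour_circle_sum _ _ (fun j => dI _)).
set A := fun z => \sum_(j < d) (coef _ _)%:~R * _.
set B := fun z => \sum_(j < d) - (coef _ _)%:~R * _.
have dA : circle_diff (c k) rho A by apply: circle_diff_sum => j; exact: dI.
have dB : circle_diff (c k) rho B by apply: circle_diff_sum => j; exact: dI.
have dAB : circle_diff (c k) rho (fun z => 1 * A z + B z).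
  by apply: circle_diffD => //; apply: circle_diffM => //; exact: circle_diff_cst.
rewrite -[X in X + _]mul1r -contour_circle_linear //; apply/eqP.
rewrite -subr_eq0 addrC -mulN1r -contour_circle_linear //; apply/eqP.
apply: (contour_circle_primitive (F := fun z => - (1) * (log_at k z * wave n z))).
  by apply: circle_diffD => //; apply: circle_diffM => //; exact: circle_diff_cst.
move=> t; have kz : on_circle k (circle_point (c k) rho t) by exists t.
have [z0 h1 h2] := on_circle_neq kz.
have dp j : has_cderiv (fun s => circle_point (c k) rho s + c j) t ('i%C * rho%:C * expi t).
  by rewrite -[c j]opprK; exact: has_cderiv_circle_sub.
have dr j := has_cderivM (dp j) (has_cderivV (h1 j) (has_cderiv_circle_sub (c k) rho (c j) t)).
have dw := has_cderiv_prod (index_enum 'I_d)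
  (fun j => has_cderiv_exprz (coef (m + j%:Z) n) (wave_factor_neq0 k j t) (dr j)).
have := has_cderivM (has_cderiv_cst (- (1)) t) (has_cderivM (has_cderiv_log_at k t) dw).
move=> /has_cderiv_eq; apply.
set P := \prod_(i <- _) _; rewrite -[P]/(wave n (circle_point (c k) rho t)) => {P}.
move: kz z0 h1 h2; rewrite -/(log_at k _).
move: (circle_point (c k) rho t) ('i%C * rho%:C * expi t) => z v kz z0 h1 h2.
set S := \sum_(i <- _) _.
(* The derivative falling on the product must cancel the two sums; the one falling on the logarithm
   then supplies [wave n z / z]. *)
suff : S * wave n z * log_at k z = - ((A z + B z) * v).
  move: S (wave n z) (log_at k z) (A z) (B z) => S W L a b e.
  transitivity (- (z^-1 * v * W) - S * W * L); first by ring.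
  by rewrite e; ring.
(* Direction by direction: for r = (z + c) / (z - c) one has (r - 1/r) / (2z) = 2c / (z^2 - c^2) = -
   r' / r. This is what the factor 1 / (2z) in the integrand of [ell] is made for. *)
rewrite /S /A /B -big_split /= !mulr_suml -sumrN; apply: eq_bigr => j _.
rewrite /ell_integrand (wave_add _ _ kz) (wave_sub _ _ kz) -/(log_at k z).
move: (wave n z) (log_at k z) (z0) (h1 j) (h2 j) => W L; move: (c j) (_%:~R) => cj nj z1 h3 h4.
by field; rewrite z1 h3 h4.
Qed.

(** Here the coefficients are natural numbers, so the product has its poles at the loop centres only
    and its residues can be summed by [total_contour_cayley]. *)
Lemma ell_constraint_window n (v : 'I_d -> nat) :
  (forall j, coef (m + j%:Z) n = v j) ->
  \sum_(j < d) (coef (m + j%:Z) n)%:~R *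
     (ell theta gamma rho m (n + unit_vec d (m + j%:Z)) -
      ell theta gamma rho m (n - unit_vec d (m + j%:Z))) =
  1 - (-1) ^+ (\sum_(j < d) v j).
Proof.
move=> nv.
have pull (I : finType) (x : R[i]) (a w1 w2 : I -> R[i]) :
    \sum_i a i * (x * w1 i - x * w2 i) = x * (\sum_i a i * w1 i + \sum_i - a i * w2 i).
  by rewrite -big_split mulr_sumr; apply: eq_bigr => i _ /=; ring.
have swap (I : finType) (a : I -> R[i]) (w : I -> I -> R[i]) :
    \sum_i a i * \sum_j w i j = \sum_j \sum_i a i * w i j.
  by rewrite exchange_big; apply: eq_bigr => i _; rewrite mulr_sumr.
transitivity ((2 * pi%:C * 'i%C)^-1 * total_contour c rho (fun z => z^-1 * wave n z)).
  rewrite pull /ell_contour !swap -big_split; congr (_ * _); apply: eq_bigr => k _.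
  exact: contour_constraint.
(* Each index j is repeated v j times, which turns powers into a product over a list. *)
pose s := flatten [seq nseq (v j) j | j <- index_enum 'I_d].
rewrite (@eq_total_contour _ _ _ _ _
  (fun z => z^-1 * \prod_(j <- s) ((z + c j) / (z - c j)))); last first.
  move=> k t; congr (_ * _); rewrite big_flatten big_map; apply: eq_bigr => j _.
  by rewrite nv big_nseq iter_mulr_1.
rewrite total_contour_cayley //; last first.
- by move=> k; rewrite normc_theta.
- by move=> j k jk; exact: directions_separated.
have -> : size s = \sum_(j < d) v j.
  rewrite size_flatten /shape -map_comp sumnE big_map.
  by apply: eq_bigr => j _; rewrite /= size_nseq.
rewrite mulKf // !mulf_neq0 ?pnatr_eq0 //.
  by rewrite eq_complex /= gt_eqF ?pi_gt0.
by rewrite eq_complex /= oner_eq0 andbF.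
Qed.
End DiscreteLogarithm.

Lemma sign_exprz_sum (R : realType) (I : finType) (a : I -> int) :
  (-1 : R[i]) ^ (\sum_i a i) = \prod_i (-1) ^ a i.
Proof.
apply: (big_morph (fun x : int => (-1 : R[i]) ^ x)); last exact: expr0z.
by move=> x y; rewrite expfzDr // oppr_eq0 oner_eq0.
Qed.

(** Replacing r by r + d changes the sign of both n_r and the difference of the values of [ell], and
    (-1)^(- a) = (-1)^a. Hence both sides may be computed in the window starting at m instead of the
    standard one. *)
Lemma ell_constraint (R : realType) (d : nat) (theta : int -> R[i])
    (gamma : int -> R) (rho : R) (hd : (0 < d)%N)
    (hdir : directions d theta gamma) (hrho : small_radius theta rho)
    (m : int) (n : 'rV[int]_d) : octant m n ->
  \sum_(l < d) (n 0 l)%:~R *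
    (ell theta gamma rho m (n + unit_vec d l.+1%:Z)
     - ell theta gamma rho m (n - unit_vec d l.+1%:Z))
  = 1 - (-1) ^ (\sum_(i < d) n 0 i) :> R[i].
Proof.
move=> [v nE]; have nv (j : 'I_d) : coef (m + j%:Z) n = v j by rewrite nE coef_octant.
pose G r := (coef r n)%:~R * (ell theta gamma rho m (n + unit_vec d r)
     - ell theta gamma rho m (n - unit_vec d r)).
have GP r : G (r + d%:Z) = G r.
  have opp2 (a : int) (x y : R[i]) : (- a)%:~R * (x - y) = a%:~R * (y - x).
    by rewrite mulrNz; ring.
  by rewrite /G coef_shift unit_vecD opprK; exact: opp2.
transitivity (\sum_(l < d) G (1 + l%:Z)).
  by apply: eq_bigr => l _; rewrite /G -intS coef_std.
rewrite -(big_int_window _ m GP) /G.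
apply: etrans (ell_constraint_window hd hdir hrho nv) _; congr (1 - _).
pose H r : R[i] := (-1) ^ coef r n.
have HP r : H (r + d%:Z) = H r.
  by rewrite /H coef_shift -{1}invrN1 exprz_inv opprK.
rewrite sign_exprz_sum; transitivity (\prod_(j < d) H (1 + j%:Z)); last first.
  by apply: eq_bigr => j _; rewrite /H -intS coef_std.
rewrite -(big_int_window _ m HP) /H -prodrXr.
by apply: eq_bigr => j _; rewrite nv.
Qed.

Lemma ell_discrete_CR (R : realType) (d : nat) (theta : int -> R[i])
    (gamma : int -> R) (rho : R) (hd : (0 < d)%N)
    (hdir : directions d theta gamma) (hrho : small_radius theta rho) :
  discrete_CR theta (ell theta gamma rho 1 : 'rV[int]_d -> R[i]).
Proof.
move=> n _ j k; rewrite !intS.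
exact: (ell_CR hd hdir hrho).
Qed.

(** * Derivatives of simple fractions and bounds on pole orders *)

Section NumFieldDerivable.
Variable K : numFieldType.
Implicit Types (z p a : K).

Lemma near_sub_neq0 z p : z != p -> \forall w \near (z : K^o), w - p != 0.
Proof.
move=> zp; apply: (@cvgr_neq0 K K^o K^o (nbhs (z : K^o)) _ (fun w : K^o => w - p) (z - p)).
  by apply: cvgB; [exact: cvg_id | exact: cvg_cst].
by rewrite subr_eq0.
Qed.

Lemma derivable_sub z p : derivable (fun w : K^o => w - p : K^o) z 1.
Proof. by apply: derivableB; [exact: derivable_id | exact: derivable_cst]. Qed.

Lemma derive1_const a z : derive1 (fun _ : K^o => a : K^o) z = 0.
Proof. by rewrite derive1E derive_cst. Qed.

Lemma derive1_sub z p : derive1 (fun w : K^o => w - p : K^o) z = 1.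
Proof.
rewrite derive1E deriveB; [|exact: derivable_id|exact: derivable_cst].
by rewrite derive_id derive_cst subr0.
Qed.

(** Provides the regular numerator required by [pole_order_le] at points other than the pole p. *)
Lemma derivable_laurent (o : nat) z0 p a z : z != p ->
  derivable (fun w : K^o => (w - z0) ^+ o * ((w - p)^-1 * a) : K^o) z 1.
Proof.
move=> zp.
apply: (@derivableM _ _ (fun w : K^o => (w - z0) ^+ o : K^o) (fun w => (w - p)^-1 * a)).
  have -> : (fun w : K^o => (w - z0) ^+ o : K^o) = (fun w : K^o => w - z0 : K^o) ^+ o.
    by apply/funext => w; rewrite fctE.
  exact/derivableX/derivable_sub.
apply: (@derivableM _ _ (fun w : K^o => (w - p)^-1 : K^o) (fun=> a)).
  apply: (@derivableV _ _ (fun w : K^o => w - p : K^o)); last exact: derivable_sub.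
  by rewrite subr_eq0.
exact: derivable_cst.
Qed.
End NumFieldDerivable.

Section PoleOrder.
Variable R : realType.
Implicit Types (z p a : R[i]) (o : nat).

Lemma pole_order_le0 o z : pole_order_le o (fun=> 0) z.
Proof.
exists (fun=> 0); split; first by near=> w; exact: derivable_cst.
by near=> w; rewrite mul0r.
Unshelve. all: by end_near.
Qed.

Lemma pole_order_leD o z (g1 g2 : R[i] -> R[i]) :
  pole_order_le o g1 z -> pole_order_le o g2 z -> pole_order_le o (fun w => g1 w + g2 w) z.
Proof.
move=> [h1 [d1 e1]] [h2 [d2 e2]]; exists (h1 \+ h2); split.
  by apply: filterS2 d1 d2 => w h1w h2w; exact: (derivableD h1w h2w).
by apply: filterS2 e1 e2 => w -> ->; rewrite -mulrDl.
Qed.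

Lemma pole_order_le_sum o z (I : Type) (r : seq I) (g : I -> R[i] -> R[i]) :
  (forall i, pole_order_le o (g i) z) -> pole_order_le o (fun w => \sum_(i <- r) g i w) z.
Proof.
move=> gP; elim: r => [|i r IH].
  have -> : (fun w => \sum_(i <- [::]) g i w) = fun=> 0.
    by apply/funext => w; rewrite big_nil.
  exact: pole_order_le0.
have -> : (fun w => \sum_(j <- i :: r) g j w) = fun w => g i w + \sum_(j <- r) g j w.
  by apply/funext => w; rewrite big_cons.
exact: pole_order_leD.
Qed.

Lemma pole_order_le_simple o z p a : (p = z -> o = 1%N) ->
  pole_order_le o (fun w => (w - p)^-1 * a) z.
Proof.
move=> po; have [pz|pz] := eqVneq p z.
  rewrite po // pz; exists (fun=> a); split; first by near=> w; exact: derivable_cst.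
  by near=> w; rewrite expr1 mulrC.
exists (fun w => (w - z) ^+ o * ((w - p)^-1 * a)); split.
  rewrite eq_sym in pz; apply: filterS (near_sub_neq0 pz) => w.
  by rewrite subr_eq0; exact: derivable_laurent.
apply: filterS (nbhs_dnbhs_neq (z : (R[i])^o)) => w wz.
have wz0 : w - z != 0 by rewrite subr_eq0.
by rewrite mulrAC mulfV ?mul1r // expf_neq0.
Unshelve. all: by end_near.
Qed.
End PoleOrder.

(** * The explicit matrices solve the recurrence *)

Section Connection.
Variables (R : realType) (d : nat) (theta : int -> R[i]) (f : 'rV[int]_d -> R[i]).
Implicit Types (n : 'rV[int]_d) (k l : 'I_d) (z : R[i]).

Lemma mx2M (a b c e a' b' c' e' : R[i]) :
  mx2 a b c e *m mx2 a' b' c' e' =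
  mx2 (a * a' + b * c') (a * b' + b * e') (c * a' + e * c') (c * b' + e * e').
Proof.
apply/matrixP => i j; rewrite !mxE !big_ord_recl big_ord0 addr0 !mxE /=.
by case: i j => [[|[|]]] // ? [[|[|]]].
Qed.

Lemma mx2D (a b c e a' b' c' e' : R[i]) :
  mx2 a b c e + mx2 a' b' c' e' = mx2 (a + a') (b + b') (c + c') (e + e').
Proof. by apply/matrixP => i j; rewrite !mxE; case: ifP => _; case: ifP. Qed.

Lemma mx2Z (x a b c e : R[i]) : x *: mx2 a b c e = mx2 (x * a) (x * b) (x * c) (x * e).
Proof. by apply/matrixP => i j; rewrite !mxE; case: ifP => _; case: ifP. Qed.

Lemma mx2_sum (I : finType) (a b c e : I -> R[i]) :
  \sum_i mx2 (a i) (b i) (c i) (e i) = mx2 (\sum_i a i) (\sum_i b i) (\sum_i c i) (\sum_i e i).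
Proof.
by apply/matrixP => i j; rewrite summxE !mxE; case: ifP => hi; case: ifP => hj;
  apply: eq_bigr => l _; rewrite mxE hi hj.
Qed.

Lemma mx2_1 : 1%:M = mx2 1 0 0 1 :> 'M[R[i]]_2.
Proof. by apply/matrixP => i j; rewrite !mxE; case: i j => [[|[|]]] // ? [[|[|]]]. Qed.

Let t l := theta l.+1%:Z.
Let e l := unit_vec d l.+1%:Z.

(** With [diag_plus] and [off_diag], the contribution of direction l to the entries of
    [simple_pole_form]; only the z^-1 term of the upper right entry is left aside. *)
Let diag_minus n z l := (z + t l)^-1 * (n 0 l)%:~R.
Let diag_plus n z l := (z - t l)^-1 * (n 0 l)%:~R.
Let off_diag n z l := (z + t l)^-1 * ((n 0 l)%:~R * - (f n + f (n - e l)))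
  + (z - t l)^-1 * ((n 0 l)%:~R * (f (n + e l) + f n)).

Lemma simple_pole_formE n z :
  simple_pole_form theta f n z =
  mx2 (\sum_l diag_minus n z l)
      (z^-1 * (-1) ^ (\sum_i n 0 i) + \sum_l off_diag n z l)
      0 (\sum_l diag_plus n z l).
Proof.
have sE l : (z + t l)^-1 *: res_minus f l n + (z - t l)^-1 *: res_plus f l n =
    mx2 (diag_minus n z l) (off_diag n z l) 0 (diag_plus n z l).
  by rewrite /res_minus /res_plus !mx2Z mx2D !mulr0 !mulr1 !addr0 !add0r.
rewrite /simple_pole_form (eq_bigr _ (fun l _ => sE l)) mx2_sum /res_zero mx2Z mx2D.
by rewrite !mulr0 !add0r big1_eq.
Qed.

Lemma pole_order_le_simple_pole_form n (i j : 'I_2) z :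
  pole_order_le (if z \in singular_points d theta then 1%N else 0%N)
    (fun w => simple_pole_form theta f n w i j) z.
Proof.
have pole p a : p \in singular_points d theta ->
    pole_order_le (if z \in singular_points d theta then 1%N else 0%N)
      (fun w => (w - p)^-1 * a) z.
  by move=> pP; apply: pole_order_le_simple => <-; rewrite pP.
have -> : (fun w => simple_pole_form theta f n w i j) =
  fun w => (w - 0)^-1 * res_zero R n i j + \sum_l
    ((w - - t l)^-1 * res_minus f l n i j + (w - t l)^-1 * res_plus f l n i j).
  apply/funext => w; rewrite /simple_pole_form mxE summxE mxE subr0; congr (_ + _).
  by apply: eq_bigr => l _; rewrite mxE mxE [X in _ + X]mxE opprK.
apply: pole_order_leD; first by apply: pole; rewrite inE eqxx.
apply: pole_order_le_sum => l; apply: pole_order_leD; apply: pole.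
- by rewrite inE mem_cat (map_f (fun l : 'I_d => - theta l.+1%:Z)) ?mem_enum ?orbT.
- by rewrite inE mem_cat (map_f (fun l : 'I_d => theta l.+1%:Z)) ?mem_enum ?orbT.
Qed.

Lemma singular_pointsP z : z \notin singular_points d theta ->
  [/\ z != 0, forall l, z + t l != 0 & forall l, z - t l != 0].
Proof.
rewrite inE negb_or mem_cat negb_or => /and3P[z0 z1 z2]; split=> // l.
  apply: contraNneq z2 => e0; rewrite (_ : z = - t l) ?map_f ?mem_enum //.
    by apply/mapP; exists l; rewrite ?mem_enum.
  by apply/eqP; rewrite -subr_eq0 opprK e0.
apply: contraNneq z1 => e0; rewrite (_ : z = t l).
  by apply/mapP; exists l; rewrite ?mem_enum.
by apply/eqP; rewrite -subr_eq0 e0.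
Qed.

(** Consequently the recurrence, multiplied by L on the right, becomes A(n + e_k) L = 1 + L A(n),
    which involves no inverse matrix. *)
Lemma mx_derive_transition n k z : mx_derive (transition theta f k n) z = 1%:M.
Proof.
apply/matrixP => i j; rewrite mx2_1 mxE.
have -> : (fun w => transition theta f k n w i j) =
    if i == ord0 then if j == ord0 then fun w => w + t k
                      else fun=> - 2 * t k * (f (n + e k) + f n)
    else if j == ord0 then fun=> 0 else fun w => w - t k.
  by apply/funext => w; rewrite mxE; case: ifP => _; case: ifP.
rewrite mxE; case: ifP => _; case: ifP => _; [|exact: derive1_const|exact: derive1_const|].
  by rewrite -[t k]opprK; exact: derive1_sub.
exact: derive1_sub.
Qed.

Lemma transition_unitmx n k z : z \notin singular_points d theta ->
  transition theta f k n z \in unitmx.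
Proof.
move=> /singular_pointsP[_ hp hm]; rewrite /transition; set q := - 2 * _ * _.
have [] // := @mulmx1_unit _ _ (mx2 (z + t k) q 0 (z - t k))
  (mx2 (z + t k)^-1 (- q / ((z + t k) * (z - t k))) 0 (z - t k)^-1).
rewrite mx2M mx2_1; congr mx2; rewrite ?(mulr0, mul0r, addr0, add0r) ?mulfV //.
by move: (hp k) (hm k) => h1 h2; field; rewrite h1 h2.
Qed.

Lemma addN_unit_vec n k i : (n - e k) 0 i = n 0 i - (k == i)%:Z.
Proof. by rewrite mxE [X in _ + X]mxE unit_vec_std. Qed.

Lemma add_unit_vec n k i : (n + e k) 0 i = n 0 i + (k == i)%:Z.
Proof. by rewrite mxE unit_vec_std. Qed.

Lemma sum_add_unit_vec n k : \sum_i (n + e k) 0 i = \sum_i n 0 i + 1.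
Proof.
rewrite (eq_bigr _ (fun i _ => add_unit_vec n k i)) big_split; congr (_ + _).
by rewrite (bigD1 k) //= eqxx big1 ?addr0 // => i; rewrite eq_sym => /negPf ->.
Qed.

Lemma orthant_add n k : orthant n -> orthant (n + e k).
Proof. by move=> n0 i; rewrite add_unit_vec addr_ge0. Qed.

Lemma orthant_sub n k : orthant n -> 0 < n 0 k -> orthant (n - e k).
Proof.
move=> n0 nk i; rewrite addN_unit_vec; have := n0 i.
by have [<-|_] := eqVneq k i; lia.
Qed.

Lemma orthant_ind (P : 'rV[int]_d -> Prop) : P 0 ->
  (forall n k, orthant n -> P n -> P (n + e k)) -> forall n, orthant n -> P n.
Proof.
move=> P0 PS n n0; have [N nN] : exists N : nat, \sum_i n 0 i = N%:Z.
  by exists `|(\sum_i n 0 i)%R|%N; rewrite gez0_abs // sumr_ge0.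
elim: N n n0 nN => [|N IH] n n0 nN.
  suff -> : n = 0 by [].
  apply/rowP => i; rewrite mxE.
  exact: (psumr_eq0P (fun i _ => n0 i) nN).
have [/existsP[k nk]|] := boolP [exists k, 0 < n 0 k].
  rewrite -[n](subrK (e k)); have nk0 := orthant_sub n0 nk.
  apply: PS => //; apply: IH => //.
  by have := sum_add_unit_vec (n - e k) k; rewrite subrK nN -addn1 PoszD => /addIr.
rewrite negb_exists => /forallP np; have : \sum_i n 0 i <= 0.
  by apply: sumr_le0 => i _; rewrite leNgt.
by rewrite nN.
Qed.

Hypothesis f_CR : discrete_CR theta f.
Hypothesis f_constraint : forall n, orthant n ->
  \sum_l (n 0 l)%:~R * (f (n + e l) - f (n - e l)) = 1 - (-1) ^ (\sum_i n 0 i) :> R[i].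

(* Both sides have the same value at z = oo, and the residues of the left-hand side
   at z = - theta_l and z = theta_l vanish by the Cauchy-Riemann equations at
   n - e_l and n. *)
Lemma off_diag_step n k z l : orthant n -> z \notin singular_points d theta ->
  let q := - 2 * t k * (f (n + e k) + f n) in let m := n + e k in
  diag_minus m z l * q + off_diag m z l * (z - t k)
  - ((z + t k) * off_diag n z l + q * diag_plus n z l) =
  (m 0 l)%:~R * (f (m + e l) - f (m - e l)) - (n 0 l)%:~R * (f (n + e l) - f (n - e l)).
Proof.
move=> n0 /singular_pointsP[_ hp hm] q m.
rewrite /diag_minus /diag_plus /off_diag /q /m add_unit_vec.
(* In the direction k itself, m - e_k = n and the coefficient grows by 1; the identity is then
   purely rational. *)
have [<-|kl] := eqVneq k l.
  rewrite addrK; move: (hp k) (hm k) => h1 h2.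
  rewrite rmorphD /=; move: (_%:~R) (f _) (f _) (f _) (f _) => N F2 F1 F0 Fm.
  by field; rewrite h1 h2.
rewrite addr0; have CR1 := f_CR n0 l k.
(* The equation at n - e_l is available only inside the orthant; the weight n_l makes the excluded
   case n_l = 0 trivial. *)
have CR2 : (n 0 l)%:~R * ((t l - t k) * (f (n + e k) - f (n - e l))) =
           (n 0 l)%:~R * ((t l + t k) * (f n - f (n + e k - e l))).
  have [->|nl] := eqVneq (n 0 l) 0; first by rewrite !mul0r.
  have nl0 : 0 < n 0 l by rewrite lt_neqAle eq_sym nl n0.
  congr (_ * _); have /= := f_CR (orthant_sub n0 nl0) l k.
  by rewrite -/(e l) -/(e k) subrK [n - e l + e k]addrAC.
move: CR1 CR2; rewrite /= -/(t l) -/(t k) -/(e l) -/(e k) [n + e l + e k]addrAC.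
move: (hp l) (hm l); move: ((n 0 l)%:~R) (f (n + e k + e l)) (f (n + e k - e l)).
move: (f (n + e k)) (f (n + e l)) (f (n - e l)) (f n) (t l) (t k).
move=> Fk Fl Fm F tl tk N Fkl Fkm h1 h2 CR1 CR2.
apply/eqP; rewrite -subr_eq0; apply/eqP.
transitivity ((N * ((tl - tk) * (Fk - Fm)) - N * ((tl + tk) * (F - Fkm))) / (z + tl) +
  N * ((tl - tk) * (Fkl - F) - (tl + tk) * (Fl - Fk)) / (z - tl)).
  by field; rewrite h1 h2.
by rewrite CR1 CR2 !subrr mulr0 !mul0r addr0.
Qed.

(** On the diagonal, raising n_k adds one fraction, which L turns into 1. In the upper right entry,
    put eps = (-1)^|n|: the steps summed over l give (1 + eps) - (1 - eps) = 2 eps by the constraint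
    at n + e_k and n, and the polar terms at 0 give - eps (z - t_k) / z - eps (z + t_k) / z = - 2
    eps. *)
Lemma simple_pole_form_step n k z : orthant n -> z \notin singular_points d theta ->
  let L := transition theta f k n z in
  simple_pole_form theta f (n + e k) z *m L = 1%:M + L *m simple_pole_form theta f n z.
Proof.
move=> n0 zP; have [z0 hp hm] := singular_pointsP zP.
have diag_sum (u : 'I_d -> R[i]) :
    \sum_l u l * ((n + e k) 0 l)%:~R = \sum_l u l * (n 0 l)%:~R + u k.
  rewrite [in RHS](bigD1 k) // [LHS](bigD1 k) //= add_unit_vec eqxx rmorphD /=.
  rewrite [X in _ + X = _](eq_bigr (fun l => u l * (n 0 l)%:~R)) /=; first by ring.
  by move=> l; rewrite eq_sym add_unit_vec => /negPf ->; rewrite addr0.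
have n0' := orthant_add k n0.
rewrite !simple_pole_formE /transition -/(t k) -/(e k).
set q := - 2 * _ * _; rewrite !mx2M mx2_1 mx2D; congr mx2.
- rewrite /diag_minus diag_sum; move: (hp k) => h1; move: (\sum_(l < d) _) => S.
  by field; rewrite z0 h1.
- have steps := eq_bigr _ (fun l (_ : true) => off_diag_step k l n0 zP).
  have := steps 0 +%R (index_enum 'I_d).
  have sumE (a b a' b' : 'I_d -> R[i]) (x y w : R[i]) :
      \sum_l (a l * x + b l * y - (w * a' l + x * b' l)) =
      (\sum_l a l) * x + (\sum_l b l) * y - (w * \sum_l a' l + x * \sum_l b' l).
    by rewrite sumrB !big_split /= !mulr_suml !mulr_sumr.
  rewrite sumE sumrB -/q.
  rewrite (f_constraint n0) (f_constraint n0') sum_add_unit_vec.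
  rewrite expfzDr ?oppr_eq0 ?oner_eq0 // expr1z mulrN1.
  move: (\sum_l diag_minus _ _ _) (\sum_l off_diag (n + e k) _ _) => S1 S2.
  move: (\sum_l off_diag _ _ _) (\sum_l diag_plus _ _ _) => S3 S4.
  move: ((-1) ^ _) (q) (t k) z0 => eps q' tk z0 h.
  transitivity ((S1 * q' + S2 * (z - tk) - ((z + tk) * S3 + q' * S4)) -
    z^-1 * eps * (z - tk) + ((z + tk) * S3 + q' * S4)); first by ring.
  by rewrite h; field.
- by rewrite !(mulr0, mul0r, addr0).
- rewrite /diag_plus diag_sum; move: (hm k) => h1; move: (\sum_(l < d) _) => S.
  by field; rewrite z0 h1.
Qed.

Lemma connection_family_simple_pole_form :
  connection_family theta f (singular_points d theta)
    (simple_pole_form theta f 0) (simple_pole_form theta f).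
Proof.
split=> // n n0 k z zP L uL; rewrite mx_derive_transition -mulmxDl.
by rewrite -simple_pole_form_step // mulmxK.
Qed.

(** Off the singular points every L_k is invertible, so the recurrence is in force at each step from
    0 to n. *)
Lemma connection_family_uniq A0 A A' :
  connection_family theta f (singular_points d theta) A0 A ->
  connection_family theta f (singular_points d theta) A0 A' ->
  forall n, orthant n -> forall z, z \notin singular_points d theta -> A n z = A' n z.
Proof.
move=> [A00 AS] [A00' AS']; apply: orthant_ind => [z zP|n k n0 IH z zP].
  by rewrite A00 ?A00'.
by rewrite AS ?AS' ?IH //; exact: transition_unitmx.
Qed.
End Connection.

Theorem theorem5p14 (R : realType) (d : nat) (theta : int -> R[i])
    (gamma : int -> R) (rho : R)
    (hd : (0 < d)%N)
    (hdir : directions d theta gamma)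
    (hrho : small_radius theta rho) :
  let ell1 : 'rV[int]_d -> R[i] := ell theta gamma rho 1 in
  [/\ isomonodromic theta ell1,
      exists A0 : R[i] -> 'M[R[i]]_2,
        (exists A, connection_family theta ell1 (singular_points d theta) A0 A) /\
        forall A, connection_family theta ell1 (singular_points d theta) A0 A ->
          forall n : 'rV[int]_d, orthant n ->
          forall z : R[i], z \notin singular_points d theta ->
            A n z = simple_pole_form theta ell1 n z
    & forall (m : int) (n : 'rV[int]_d), octant m n ->
        \sum_(l < d) (n 0 l)%:~R *
          (ell theta gamma rho m (n + unit_vec d l.+1%:Z)
           - ell theta gamma rho m (n - unit_vec d l.+1%:Z))
        = 1 - (-1) ^ (\sum_(i < d) n 0 i) :> R[i] ].
Proof.
move=> ell1; have CR : discrete_CR theta ell1 := ell_discrete_CR hd hdir hrho.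
have constraint n (n0 : orthant n) := ell_constraint hd hdir hrho (octant1 n0).
have family := connection_family_simple_pole_form CR constraint.
split.
- split=> //; exists (singular_points d theta), (fun=> 1%N).
  exists (simple_pole_form theta ell1 0), (simple_pole_form theta ell1); split=> //.
  by move=> n _ i j z; exact: pole_order_le_simple_pole_form.
(* All n_l vanish at the origin, so this initial value is z^-1 times the nilpotent matrix with a
   single entry 1 in the upper right corner. *)
- exists (simple_pole_form theta ell1 0); split; first by exists (simple_pole_form theta ell1).
  by move=> A hA n n0 z zP; exact: connection_family_uniq hA family n n0 z zP.
- exact: ell_constraint.
Qed.
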